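(* For every real $\delta>0$ there is a constant $C=C(\delta)$ such that the following holds. Let $\mathbb{F}=\mathbb{F}_q$ be any prime field, let $n,k\ge 1$, and let $f:\mathbb{F}^n\to\mathbb{F}$ be a polynomial of degree five that is an affine disperser for dimension $k$. Then $f$ is an affine extractor for dimension $Ck$ with bias $\delta$.
   Context: For a finite prime field $\mathbb{F}$, a nonempty affine subspace $V\subseteq\mathbb{F}^n$ and a function $f:\mathbb{F}^n\to\mathbb{F}$, $\mathrm{bias}(f|_V):=\left|\mathbb{E}_{x\in V}\left[\omega^{f(x)}\right]\right|$, where $\omega=e^{2\pi i/|\mathbb{F}|}$ and $x$ is uniform in $V$. The function $f$ is an affine disperser for dimension $k$ if $f|_V$ is not constant for every affine subspace $V\subseteq\mathbb{F}^n$ of dimension at least $k$. The function $f$ is an affine extractor for dimension $m$ with bias $\delta$ if $\mathrm{bias}(f|_V)\le\delta$ for every affine subspace $V\subseteq\mathbb{F}^n$ of dimension at least $m$. Polynomials are regarded as functions $\mathbb{F}^n\to\mathbb{F}$; the degree of such a function is the total degree of its unique representation as a polynomial with each individual degree at most $|\mathbb{F}|-1$. *)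

(* Defs.v *)
From mathcomp Require Import all_boot all_order all_algebra.
From mathcomp Require mpoly.

Set Implicit Arguments.
Unset Strict Implicit.
Unset Printing Implicit Defensive.

Import GRing.Theory Num.Theory.
Local Open Scope ring_scope.

(* The notations of mpoly clash with those of mathcomp-analysis, so mpoly is
   imported only inside this section. *)
Section PolynomialFunctions.
Import mpoly.

Definition poly_represents (q n : nat)
    (p : {mpoly 'F_q[n]}) (f : 'rV['F_q]_n -> 'F_q) : Prop :=
  forall x : 'rV['F_q]_n, f x = p.@[fun i => x ord0 i].

(* Individual degrees at most |F| - 1, where q is prime and so |'F_q| = q. *)
Definition reduced_poly (q n : nat) (p : {mpoly 'F_q[n]}) : Prop :=
  forall m : 'X_{1..n}, m \in msupp p -> forall i : 'I_n, (m i <= q.-1)%N.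

(* msize p is one more than the total degree of a nonzero p. *)
Definition has_degree (q n : nat) (f : 'rV['F_q]_n -> 'F_q) (d : nat) : Prop :=
  exists p : {mpoly 'F_q[n]},
    [/\ reduced_poly p, poly_represents p f & msize p = d.+1].

End PolynomialFunctions.

From mathcomp Require Import all_classical all_reals all_analysis.
From mathcomp Require Import complex.

Definition affine_subspace (F : finFieldType) (n : nat)
    (v : 'rV[F]_n) (U : {vspace 'rV[F]_n}) : {set 'rV[F]_n} :=
  [set v + u | u in U]%SET.

Definition omega (R : realType) (q : nat) : R[i] :=
  Complex (cos (2 * pi / q%:R)) (sin (2 * pi / q%:R)).

(* The exponent is the representative of f x in {0, ..., q - 1}. *)
Definition bias (R : realType) (q n : nat)
    (f : 'rV['F_q]_n -> 'F_q) (V : {set 'rV['F_q]_n}) : R :=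
  ComplexField.Normc.normc
    ((#|V|%:R)^-1 * \sum_(x in V) omega R q ^+ (f x : nat)).

Definition affine_disperser (q n : nat)
    (f : 'rV['F_q]_n -> 'F_q) (k : nat) : Prop :=
  forall (v : 'rV['F_q]_n) (U : {vspace 'rV['F_q]_n}),
    (k <= \dim U)%N ->
    ~ (exists c : 'F_q, forall x, x \in affine_subspace v U -> f x = c).

(* The dimension bound m is real, so that it can be C * k with C real. *)
Definition affine_extractor (R : realType) (q n : nat)
    (f : 'rV['F_q]_n -> 'F_q) (m delta : R) : Prop :=
  forall (v : 'rV['F_q]_n) (U : {vspace 'rV['F_q]_n}),
    m <= (\dim U)%:R -> bias R f (affine_subspace v U) <= delta.

(* Main.v *)
Require Import Defs.
From mathcomp Require Import all_boot all_order all_algebra.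
From mathcomp Require Import complex ring lra zify reals.
From mathcomp Require boolp mpoly.

(** A function is treated through its iterated differences: f has degree at
    most d when all its differences of order d+1 vanish, and then the d-th
    difference T of f is a symmetric d-linear form.  Cauchy-Schwarz bounds the
    bias of f by that of T, that is, by the probability [zbias] that contracting
    T with d-1 random vectors gives the zero linear form ([bias_le_zbias]).

    The heart of the proof is that a biased symmetric d-linear form on F^m with
    d <= 5 vanishes identically on a subspace of dimension at least m/C - 1,
    where C depends only on the bias and not on the field ([zeroable_le5]).
    Given this, f has degree at most d-1 on every coset of that subspace, and
    on one of the cosets it is at least as biased as on the whole space; so the
    degree goes down to 0 and f is constant on a subspace of proportional
    dimension ([biased_const]), which a disperser forbids.

    For d = 1 the subspace is a kernel and for d = 2 a totally isotropic space,
    which exists without any bias.  For 3 <= d <= 5 one proves for s = 1, ..., d-1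
    in turn that, on a subspace of proportional dimension, contracting T with
    ANY s vectors leaves a biased form ([bias_step]); for s = d-1 a biased linear
    form is the zero form.  The step to s rests on three facts.
    - Bias is supermultiplicative under addition of forms ([zbiasD]).  With
      Fourier analysis this gives, for fixed X = (x_1, ..., x_(s-1)), that
      T(X, y, .) is biased for each y that annihilates the typical values of
      the random linear form T(X, ., a) ([zbias_fourier]).
    - For most X those typical values are met by a bounded number of samples
      a = b_1, ..., b_M, the same for all X ([hitting_set]).  Hence T(X, y, .)
      is biased as soon as the s-linear forms T(., b_i) vanish at (X, y).
    - By induction these s-linear forms, and the forms in fewer variables that
      arise when X is translated, can be killed on a subspace U: those in three
      or more variables come from T by fixing at most 5 - 3 = 2 vectors, so they
      are biased.  (With six variables one would have to fix three vectors to get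
      a trilinear form, and the argument breaks down.)  This yields a coset of
      U^(s-1) most of whose points X are good for all y in U ([coset_kill]); an
      arbitrary point of U^(s-1) is an alternating sum over a cube of good ones,
      and supermultiplicativity applies again ([zbias_cube]). *)

Set Implicit Arguments.
Unset Strict Implicit.
Unset Printing Implicit Defensive.
Import Order.TTheory GRing.Theory Num.Theory.
Local Open Scope ring_scope.

Local Notation normc := ComplexField.Normc.normc.

(** * Averages over finite types *)

Definition avg (K : numFieldType) (I : finType) (f : I -> K) : K :=
  #|I|%:R^-1 * \sum_i f i.

Section Averages.
Context {K : numFieldType}.
Implicit Types I J : finType.

Lemma eq_avg I (f g : I -> K) : f =1 g -> avg f = avg g.
Proof. by move=> fg; rewrite /avg (eq_bigr g). Qed.

Lemma avg_const I (c : K) : (0 < #|I|)%N -> avg (fun _ : I => c) = c.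
Proof.
move=> I0; rewrite /avg sumr_const -(mulr_natl c) mulrA mulVf ?mul1r //.
by rewrite pnatr_eq0 -lt0n.
Qed.

Lemma avgD I (f g : I -> K) : avg (fun i => f i + g i) = avg f + avg g.
Proof. by rewrite /avg big_split mulrDr. Qed.

Lemma avgZ I (c : K) (f : I -> K) : avg (fun i => c * f i) = c * avg f.
Proof. by rewrite /avg -mulr_sumr mulrCA. Qed.

Lemma avgZr I (c : K) (f : I -> K) : avg (fun i => f i * c) = avg f * c.
Proof. by rewrite /avg -mulr_suml mulrA. Qed.

Lemma avgN I (f : I -> K) : avg (fun i => - f i) = - avg f.
Proof. by rewrite /avg sumrN mulrN. Qed.

Lemma avgB I (f g : I -> K) : avg (fun i => f i - g i) = avg f - avg g.
Proof. by rewrite avgD avgN. Qed.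

Lemma avg_exchange I J (f : I -> J -> K) :
  avg (fun i => avg (f i)) = avg (fun j => avg (f^~ j)).
Proof.
rewrite /avg -!mulr_sumr exchange_big /=.
by rewrite !mulrA [X in X * _]mulrC.
Qed.

Lemma avgM I J (f : I -> K) (g : J -> K) :
  avg f * avg g = avg (fun i => avg (fun j => f i * g j)).
Proof. by rewrite -avgZr; apply: eq_avg => i; rewrite -avgZ. Qed.

Lemma avg_reindex I J (h : I -> J) (f : J -> K) :
  bijective h -> avg (f \o h) = avg f.
Proof.
move=> bh; rewrite /avg (bij_eq_card bh); congr (_ * _).
by rewrite [RHS](reindex h) //; exact: onW_bij.
Qed.

Lemma avg_ge0 I (f : I -> K) : (forall i, 0 <= f i) -> 0 <= avg f.
Proof. by move=> f0; rewrite mulr_ge0 ?invr_ge0 ?ler0n ?sumr_ge0. Qed.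

Lemma ler_avg I (f g : I -> K) : (forall i, f i <= g i) -> avg f <= avg g.
Proof. by move=> fg; rewrite ler_wpM2l ?invr_ge0 ?ler0n ?ler_sum. Qed.

Lemma norm_avg I (f : I -> K) : `|avg f| <= avg (fun i => `|f i|).
Proof.
rewrite normrM normfV normr_nat.
by rewrite ler_wpM2l ?invr_ge0 ?ler0n // ler_norm_sum.
Qed.

(** Averages over k-tuples, applied to functions of sequences so that the
    coordinates can be split off one by one by [avgsS]. *)
Definition avgs (V : finType) k (h : seq V -> K) : K :=
  avg (fun t : k.-tuple V => h t).

Lemma eq_avgs (V : finType) k (f g : seq V -> K) :
  (forall s, size s = k -> f s = g s) -> avgs k f = avgs k g.
Proof. by move=> fg; apply: eq_avg => t; rewrite fg ?size_tuple. Qed.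

Lemma avgs0 (V : finType) (h : seq V -> K) : avgs 0 h = h [::].
Proof.
rewrite -[RHS](@avg_const (0.-tuple V)) ?card_tuple //.
by apply: eq_avg => t; rewrite (tuple0 t).
Qed.

Lemma avgsS (V : finType) k (h : seq V -> K) :
  avgs k.+1 h = avg (fun x => avgs k (fun s => h (x :: s))).
Proof.
rewrite /avgs /avg card_tuple -mulr_sumr mulrA -invfM -natrM card_tuple -expnS.
congr (_ * _); rewrite pair_big /=.
rewrite (reindex (fun p : V * k.-tuple V => [tuple of p.1 :: p.2])) //=.
exists (fun t : k.+1.-tuple V => (thead t, [tuple of behead t])) => t _ /=.
  by case: t => x t /=; rewrite theadE; congr pair; apply: val_inj.
by rewrite [RHS]tuple_eta; apply: val_inj.
Qed.

End Averages.

Lemma avg_le_ex (R : realFieldType) (I : finType) (f : I -> R) (c : R) :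
  (0 < #|I|)%N -> avg f <= c -> exists i, f i <= c.
Proof.
move=> I0 fc; have [/existsP[i ?]|] := boolP [exists i, f i <= c].
  by exists i.
rewrite negb_exists => /forallP h; suff: c < avg f by rewrite ltNge fc.
rewrite -(@avg_const R I c) // /avg ltr_pM2l ?invr_gt0 ?ltr0n //.
have /card_gt0P[i0 _] := I0.
apply: ltr_sum => [|i _]; last by rewrite ltNge h.
by apply/hasP; exists i0 => //; rewrite mem_index_enum.
Qed.

Lemma avg_ge_ex (R : realFieldType) (I : finType) (f : I -> R) (c : R) :
  (0 < #|I|)%N -> c <= avg f -> exists i, c <= f i.
Proof.
move=> I0 fc; have [|i] := @avg_le_ex _ I (fun i => - f i) (- c) I0.
  by rewrite avgN lerN2.
by rewrite lerN2; exists i.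
Qed.

Lemma avg_sqr (R : realFieldType) (I : finType) (f : I -> R) :
  (0 < #|I|)%N -> avg f ^+ 2 <= avg (fun i => f i ^+ 2).
Proof.
move=> I0; set m := avg f.
have : 0 <= avg (fun i => (f i - m) ^+ 2) by apply: avg_ge0 => i; exact: sqr_ge0.
rewrite (@eq_avg _ _ _ (fun i => f i ^+ 2 - (2 * m) * f i + m ^+ 2)); last first.
  by move=> i; ring.
rewrite avgD avgB avgZ avg_const // -/m; lra.
Qed.

Local Open Scope complex_scope.

(** * Symmetric multilinear forms *)

Lemma card_rV_gt0 (F : finFieldType) m : (0 < #|{: 'rV[F]_m}|)%N.
Proof. by apply/card_gt0P; exists 0. Qed.

Lemma card_tuple_rV_gt0 (F : finFieldType) m k :
  (0 < #|{: k.-tuple 'rV[F]_m}|)%N.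
Proof. by rewrite card_tuple expn_gt0 card_rV_gt0. Qed.


Section Forms.
Context {F : finFieldType}.

(** A k-linear form is a function on sequences constrained at length k only.
    Linearity at the head and symmetry give linearity in each slot. *)
Definition symml m k (T : seq 'rV[F]_m -> F) : Prop :=
  (forall s t, size s = k -> perm_eq s t -> T s = T t) /\
  (forall a (x y : 'rV[F]_m) s, (size s).+1 = k ->
     T ((a *: x + y) :: s) = a * T (x :: s) + T (y :: s)).

(** A subspace is given by a matrix A whose rows span it; [pull A] carries its
    coordinate vectors to the ambient space. *)
Definition pull m p (A : 'M[F]_(p, m)) (s : seq 'rV[F]_p) : seq 'rV[F]_m :=
  [seq u *m A | u <- s].

Lemma size_pull m p (A : 'M[F]_(p, m)) s : size (pull A s) = size s.
Proof. exact: size_map. Qed.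

Lemma pull_mul m p r (A : 'M[F]_(p, m)) (B : 'M[F]_(r, p)) s :
  pull (B *m A) s = pull A (pull B s).
Proof. by rewrite /pull -map_comp; apply: eq_map => u /=; rewrite mulmxA. Qed.

Section OneForm.
Context {m : nat}.
Implicit Types (T S : seq 'rV[F]_m -> F) (s t : seq 'rV[F]_m).

Lemma symml_perm k T s t :
  symml k T -> size s = k -> perm_eq s t -> T s = T t.
Proof. by case=> + _; apply. Qed.

Lemma symmlP k T a (x y : 'rV[F]_m) s : symml k T -> (size s).+1 = k ->
  T ((a *: x + y) :: s) = a * T (x :: s) + T (y :: s).
Proof. by case=> _; apply. Qed.

Lemma symmlD k T (x y : 'rV[F]_m) s : symml k T -> (size s).+1 = k ->
  T ((x + y) :: s) = T (x :: s) + T (y :: s).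
Proof. by move=> hT hs; rewrite -{1}[x]scale1r (symmlP _ _ _ hT hs) mul1r. Qed.

Lemma symml0 k T s : symml k T -> (size s).+1 = k -> T (0 :: s) = 0.
Proof.
move=> hT hs; have := symmlP (-1) 0 0 hT hs.
by rewrite scaler0 addr0 mulN1r addNr.
Qed.

Lemma symmlB k T (x y : 'rV[F]_m) s : symml k T -> (size s).+1 = k ->
  T ((x - y) :: s) = T (x :: s) - T (y :: s).
Proof.
by move=> hT hs; rewrite addrC -scaleN1r (symmlP _ _ _ hT hs) mulN1r addrC.
Qed.

Lemma symml_cat j k T w :
  symml k T -> (size w + j = k)%N -> symml j (fun s => T (w ++ s)).
Proof.
move=> hT wj; split=> [s t sj st | a x y s sj].
  by apply: (symml_perm hT); rewrite ?size_cat ?sj // perm_cat2l.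
have mid z : T (w ++ z :: s) = T (z :: w ++ s).
  apply: (symml_perm hT); first by rewrite size_cat /= sj.
  by rewrite -cat1s perm_catCA.
by rewrite !mid (symmlP _ _ _ hT) // size_cat -addnS sj.
Qed.

Lemma symml_cons k T x : symml k.+1 T -> symml k (fun s => T (x :: s)).
Proof. by move=> hT; apply: (@symml_cat _ _ _ [:: x] hT). Qed.

Lemma symmlDf k T S : symml k T -> symml k S -> symml k (fun s => T s + S s).
Proof.
move=> hT hS; split=> [s t sk st | a x y s sk].
  by rewrite (symml_perm hT sk st) (symml_perm hS sk st).
by rewrite (symmlP _ _ _ hT sk) (symmlP _ _ _ hS sk); ring.
Qed.

Lemma symmlNf k T : symml k T -> symml k (fun s => - T s).
Proof.
move=> hT; split=> [s t sk st | a x y s sk].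
  by rewrite (symml_perm hT sk st).
by rewrite (symmlP _ _ _ hT sk); ring.
Qed.

Lemma symml_pull k T p (A : 'M[F]_(p, m)) :
  symml k T -> symml k (fun r => T (pull A r)).
Proof.
move=> hT; split=> [s t sk st | a x y s sk].
  by apply: (symml_perm hT); rewrite ?size_pull // perm_map.
by rewrite /pull /= mulmxDl -scalemxAl (symmlP _ _ _ hT) ?size_map.
Qed.

End OneForm.
End Forms.

Section Shift.
Context {F : finFieldType}.

Definition sadd m (s t : seq 'rV[F]_m) : seq 'rV[F]_m :=
  [seq p.1 + p.2 | p <- zip s t].

Lemma size_sadd m (s t : seq 'rV[F]_m) :
  size s = size t -> size (sadd s t) = size t.
Proof. by move=> st; rewrite size_map size_zip st minnn. Qed.

Lemma saddC m (s t : seq 'rV[F]_m) : sadd s t = sadd t s.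
Proof.
elim: s t => [|x s IHs] [|y t] //=; rewrite /sadd /=.
by congr (_ :: _); [rewrite addrC | exact: IHs].
Qed.

Lemma avgs_sadd (K : numFieldType) m k (h : seq 'rV[F]_m -> K) (c : seq 'rV[F]_m) :
  size c = k -> avgs k (fun s => h (sadd s c)) = avgs k h.
Proof.
elim: k h c => [|k IHk] h [|c0 c] // => [_|[sc]]; first by rewrite !avgs0.
rewrite !avgsS -[RHS](@avg_reindex _ _ _ (+%R^~ c0)).
  by apply: eq_avg => x /=; rewrite -(IHk (fun s => h (x + c0 :: s)) c sc).
by exists (fun y => y - c0) => y; rewrite ?addrK ?subrK.
Qed.

End Shift.

(** * Bias of a multilinear form *)

Section Bias.
Context {R : rcfType} {F : finFieldType}.

(** For T in k+1 variables.  This counts the k-tuples that annihilate T, so it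
    is visibly a nonnegative real; it equals the exponential sum of T by
    [zbias_char]. *)
Definition zbias m k (T : seq 'rV[F]_m -> F) : R :=
  avgs k (fun t : seq 'rV[F]_m => [forall y, T (y :: t) == 0]%:R).

Lemma zbias_ge0 m k (T : seq 'rV[F]_m -> F) : 0 <= zbias k T.
Proof. by apply: avg_ge0 => t; rewrite ler0n. Qed.

Lemma eq_zbias m k (T S : seq 'rV[F]_m -> F) :
  (forall s, size s = k.+1 -> T s = S s) -> zbias k T = zbias k S.
Proof.
move=> TS; apply: eq_avgs => t tk; congr (nat_of_bool _)%:R.
by apply: eq_forallb => y; rewrite TS //= tk.
Qed.

Lemma zbiasN m k (T : seq 'rV[F]_m -> F) : zbias k (fun s => - T s) = zbias k T.
Proof.
apply: eq_avgs => t tk; congr (nat_of_bool _)%:R.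
by apply: eq_forallb => y; rewrite oppr_eq0.
Qed.

Lemma zbiasS m k (T : seq 'rV[F]_m -> F) : symml k.+2 T ->
  zbias k.+1 T = avg (fun x => zbias k (fun s => T (x :: s))).
Proof.
move=> hT; rewrite /zbias avgsS; apply: eq_avg => x; apply: eq_avgs => t tk.
congr (nat_of_bool _)%:R; apply: eq_forallb => y; congr (_ == 0).
apply: (symml_perm hT); first by rewrite /= tk.
by rewrite -(cat1s x) -(cat1s y) perm_catCA.
Qed.


Definition is_char (chi : F -> R[i]) : Prop :=
  [/\ forall a b, chi (a + b) = chi a * chi b,
      forall a, `|chi a| = 1 & exists a, chi a != 1].

Section Char.
Context {chi : F -> R[i]}.
Context (chiP : is_char chi).

Lemma charD a b : chi (a + b) = chi a * chi b.
Proof. by case: chiP. Qed.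

Lemma norm_char a : `|chi a| = 1.
Proof. by case: chiP. Qed.

Lemma char0 : chi 0 = 1.
Proof.
have /eqP : chi 0 * chi 0 = chi 0 * 1 by rewrite -charD addr0 mulr1.
by rewrite (inj_eq (mulfI _)) => [/eqP //|]; rewrite -normr_eq0 norm_char oner_eq0.
Qed.

Lemma avg_char_linear m (l : 'rV[F]_m -> F) :
  (forall a x y, l (a *: x + y) = a * l x + l y) ->
  avg (fun y => chi (l y)) = [forall y, l y == 0]%:R.
Proof.
move=> lin; case: (boolP [forall y, _]) => [/forallP l0|].
  rewrite -[RHS](@avg_const _ 'rV[F]_m) ?card_rV_gt0 //.
  by apply: eq_avg => y; rewrite (eqP (l0 y)) char0.
case/forallPn => y0 ly0; case: chiP => _ _ [a ha].
(* l takes every value, in particular one that chi moves. *)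
pose h := (a / l y0) *: y0.
have lh y : l (h + y) = a + l y by rewrite lin divfK.
have shift : avg (fun y => chi (l y)) = chi a * avg (fun y => chi (l y)).
  rewrite -avgZ -[LHS](@avg_reindex _ _ _ (+%R h)).
    by apply: eq_avg => y; rewrite /= lh charD.
  by exists (fun y => - h + y) => y; rewrite ?addKr ?addNKr.
apply/eqP; move/eqP: shift.
rewrite -subr_eq0 -{1}[X in X - _]mul1r -mulrBl mulf_eq0 subr_eq0.
by rewrite eq_sym (negPf ha).
Qed.

Lemma avg_C (I : finType) (f : I -> R) : (avg f)%:C = avg (fun i => (f i)%:C).
Proof. by rewrite rmorphM rmorph_sum fmorphV rmorph_nat. Qed.

Lemma zbias_char m k (T : seq 'rV[F]_m -> F) : symml k.+1 T ->
  (zbias k T)%:C = avgs k.+1 (fun s => chi (T s)).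
Proof.
move=> hT; rewrite avgsS avg_exchange avg_C; apply: eq_avg => t /=.
rewrite avg_char_linear ?rmorph_nat // => a x y.
by rewrite (symmlP _ _ _ hT) ?size_tuple.
Qed.

(** Restricting to a subspace can only increase the bias.  A linear form that
    vanishes on the space vanishes on the subspace; the exponential sum lets each
    variable in turn be the one that is left free. *)
Lemma zbias_pull m k (T : seq 'rV[F]_m -> F) p (A : 'M[F]_(p, m)) :
  symml k.+1 T -> zbias k T <= zbias k (fun s => T (pull A s)).
Proof.
elim: k T => [|k IHk] T hT.
  rewrite /zbias !avgs0 ler_nat.
  case: (boolP [forall y, _]) => // /forallP h0.
  by case: (boolP [forall y, _]) => // /negP[]; apply/forallP => u; exact: h0.
have step : avg (fun x => zbias k (fun s => T (x :: pull A s))) =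
    avgs k.+1 (fun u => [forall x, T (x :: pull A u) == 0]%:R).
  apply: complexI; rewrite !avg_C.
  have hx x : symml k.+1 (fun s => T (x :: pull A s)).
    exact: (symml_pull (T := fun s => T (x :: s)) A (symml_cons x hT)).
  under eq_avg => x do rewrite zbias_char //.
  rewrite /avgs avg_exchange; apply: eq_avg => u.
  rewrite rmorph_nat avg_char_linear // => a x y.
  by rewrite (symmlP _ _ _ hT) // size_pull size_tuple.
rewrite zbiasS //; apply: le_trans (_ : avg (fun x =>
    zbias k (fun s => T (x :: pull A s))) <= _).
  by apply: ler_avg => x; apply: IHk; exact: symml_cons.
rewrite step; apply: ler_avg => u; rewrite ler_nat.
case: (boolP [forall y, _]) => // /forallP h0.
by case: (boolP [forall y, _]) => // /negP[]; apply/forallP => x; exact: h0.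
Qed.

(** The summand is an affine function of the first variable, so averaging over
    that variable gives 0 or a complex number of modulus 1 according to the
    linear part; the translation c0 only affects the phase. *)
Lemma norm_avg_head m k (A B : seq 'rV[F]_m -> F) c0 (c : seq 'rV[F]_m) :
  symml k.+1 A -> symml k.+1 B -> size c = k ->
  `|avgs k.+1 (fun s => chi (A s + B (sadd s (c0 :: c))))|
    <= avgs k (fun t => avg (fun y => chi (A (y :: t) + B (y :: sadd t c)))).
Proof.
move=> hA hB sc; rewrite avgsS avg_exchange; apply: le_trans (norm_avg _) _.
apply: ler_avg => t; set phi := fun y => A (y :: t) + B (y :: sadd t c).
have st : size t = size c by rewrite size_tuple.
have lin a x y : phi (a *: x + y) = a * phi x + phi y.
  rewrite /phi (symmlP _ _ _ hA) ?size_tuple // (symmlP _ _ _ hB) ?size_sadd ?size_tuple ?sc //.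
  by ring.
rewrite (@eq_avg _ _ _ (fun y => chi (B (c0 :: sadd t c)) * chi (phi y))).
  rewrite avgZ normrM norm_char mul1r (avg_char_linear lin).
  by rewrite ger0_norm ?ler0n.
move=> y; rewrite -charD /phi /sadd /= (symmlD _ _ hB) ?size_sadd ?size_tuple ?sc //.
by congr (chi _); ring.
Qed.

(** Translating B adds to A + B terms in fewer variables, and such terms can
    only decrease the modulus of an exponential sum: this follows by removing
    the translation one variable at a time. *)
Lemma norm_avg_shift m k (A B : seq 'rV[F]_m -> F) (c : seq 'rV[F]_m) :
  symml k.+1 A -> symml k.+1 B -> size c = k.+1 ->
  `|avgs k.+1 (fun s => chi (A s + B (sadd s c)))|
    <= (zbias k (fun s => A s + B s))%:C.
Proof.
elim: k A B c => [|k IHk] A B [|c0 c] // hA hB [sc];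
    have head := norm_avg_head c0 hA hB sc; apply: le_trans (head) _.
  case: c sc {head} => // _; rewrite (zbias_char (symmlDf hA hB)) avgsS.
  by rewrite !avgs0 le_eqVlt; apply/orP; left; apply/eqP/eq_avg => y; rewrite avgs0.
rewrite -[X in X <= _]ger0_norm; last exact: le_trans (normr_ge0 _) head.
rewrite (zbiasS (symmlDf hA hB)) avg_C /avgs avg_exchange.
apply: le_trans (norm_avg _) _; apply: ler_avg => y.
exact: IHk (symml_cons y hA) (symml_cons y hB) sc.
Qed.

(** The left-hand side is the average of chi (A s + B t) over independent s and
    t; after the substitution t := t + s every inner average over s is one of the
    sums of [norm_avg_shift]. *)
Lemma zbiasD m k (A B : seq 'rV[F]_m -> F) : symml k.+1 A -> symml k.+1 B ->
  zbias k A * zbias k B <= zbias k (fun s => A s + B s).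
Proof.
move=> hA hB; rewrite -lecR rmorphM /= (zbias_char hA) (zbias_char hB) avgM.
rewrite (@eq_avg _ _ _ (fun s : k.+1.-tuple 'rV[F]_m =>
  avgs k.+1 (fun c => chi (A s + B (sadd c s))))); last first.
  move=> s; rewrite (@avgs_sadd _ _ _ _ (fun c => chi (A s + B c))) ?size_tuple //.
  by apply: eq_avg => c; rewrite charD.
(* The average is a product of biases, hence real: it equals its modulus. *)
rewrite avg_exchange -[X in X <= _]ger0_norm; last first.
  rewrite avg_exchange (@eq_avg _ _ _ (fun s : k.+1.-tuple 'rV[F]_m =>
    (zbias k B)%:C * chi (A s))).
    rewrite avgZ -[avg _]/(avgs k.+1 (fun s => chi (A s))) -(zbias_char hA).
    by rewrite -rmorphM ler0c mulr_ge0 ?zbias_ge0.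
  move=> s; transitivity (avgs k.+1 (fun c => chi (A s + B c))).
    exact: (avgs_sadd (fun c => chi (A s + B c)) (size_tuple s)).
  by rewrite (zbias_char hB) /avgs -avgZr; apply: eq_avg => c; rewrite charD mulrC.
apply: le_trans (norm_avg _) _.
rewrite -[X in _ <= X](@avg_const _ (k.+1.-tuple 'rV[F]_m)) ?card_tuple_rV_gt0 //.
apply: ler_avg => c; rewrite (@eq_avg _ _ _ (fun s : k.+1.-tuple 'rV[F]_m =>
  chi (A s + B (sadd s c)))); first exact: norm_avg_shift (size_tuple _).
by move=> s; rewrite saddC.
Qed.

Lemma zbiasB m k (A B : seq 'rV[F]_m -> F) : symml k.+1 A -> symml k.+1 B ->
  zbias k A * zbias k B <= zbias k (fun s => A s - B s).
Proof.
by move=> hA hB; rewrite -(zbiasN k B); apply: zbiasD => //; exact: symmlNf.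
Qed.

End Char.
End Bias.

(** * Sampling the typical values of a random variable *)

Section Hitting.
Context {R : realFieldType} {A : finType} {K : eqType}.
Implicit Types (x : A -> K) (B : seq A).

(** The probability that an independent copy takes the same value as x at a. *)
Definition collision x (a : A) : R := avg (fun b => (x b == x a)%:R).

(** Weighting by the collision probability makes only the typical values count:
    it is exactly the weight with which a value enters the convolution used in
    [zbias_fourier]. *)
Definition missed x B : R :=
  avg (fun a => collision x a * (x a \notin [seq x b | b <- B])%:R).

Lemma collision_ge0 x a : 0 <= collision x a.
Proof. by apply: avg_ge0 => b; rewrite ler0n. Qed.

Lemma missed_ge0 x B : 0 <= missed x B.
Proof. by apply: avg_ge0 => a; rewrite mulr_ge0 ?collision_ge0 ?ler0n. Qed.

(** Adding a random sample a removes in expectation the average of the squared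
    weights, which is at least the square of the average weight. *)
Lemma missed_step (I : finType) (xi : I -> A -> K) B :
  (0 < #|I|)%N -> (0 < #|A|)%N ->
  let u B := avg (fun i => missed (xi i) B) in
  exists a, u (a :: B) <= u B - u B ^+ 2.
Proof.
move=> I0 A0 u; apply: (avg_le_ex A0).
pose w i a : R := (xi i a \notin [seq xi i b | b <- B])%:R.
have w2 i a : w i a * w i a = w i a by rewrite -natrM mulnb andbb.
have next : avg (fun a => u (a :: B)) =
    u B - avg (fun i => avg (fun a => (collision (xi i) a * w i a) ^+ 2)).
  rewrite /u avg_exchange -avgB; apply: eq_avg => i.
  rewrite avg_exchange /missed -avgB; apply: eq_avg => a.
  rewrite avgZ (@eq_avg _ _ _ (fun b => w i a - w i a * (xi i b == xi i a)%:R)).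
    rewrite avgB avg_const // avgZ -/(collision _ _) exprMn (expr2 (w i a)) w2; ring.
  move=> b; rewrite /w inE negb_or eq_sym -mulnb natrM.
  by case: (xi i b == xi i a); rewrite /= ?mulr1 ?mulr0 ?mul1r ?mul0r ?subrr ?subr0.
rewrite next lerD2l lerN2; apply: le_trans (avg_sqr _ I0) _.
by apply: ler_avg => i; exact: avg_sqr.
Qed.

End Hitting.

(** As long as the missed mass exceeds theta, each new sample lowers it by
    theta ^ 2, so M of order theta ^ -2 samples suffice, whatever the types. *)
Lemma hitting_set (R : archiRealFieldType) (theta : R) : 0 < theta ->
  exists M, forall (I A : finType) (K : eqType) (xi : I -> A -> K),
    (0 < #|I|)%N -> (0 < #|A|)%N ->
    exists2 B : seq A, (size B <= M)%N & avg (fun i => missed (xi i) B) <= theta.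
Proof.
move=> th0; pose M := Num.truncn (theta ^- 2); exists M.+1 => I A K xi I0 A0.
have : exists2 B : seq A, (size B <= M.+1)%N &
    avg (fun i => missed (xi i) B) <= theta \/
    avg (fun i => missed (xi i) B) <= 1 - M.+1%:R * theta ^+ 2 :> R.
  elim: M.+1 => [|j [B sB [hB | hB]]].
  - exists [::] => //; right; rewrite mul0r subr0.
    rewrite -[X in _ <= X](@avg_const _ I) //; apply: ler_avg => i.
    rewrite -[X in _ <= X](@avg_const _ A) //; apply: ler_avg => a.
    rewrite mulr1 -[X in _ <= X](@avg_const _ A) //; apply: ler_avg => b.
    by rewrite lern1 leq_b1.
  - by exists B; [exact: leq_trans sB _ | left].
  case: (lerP (avg (fun i => missed (xi i) B)) theta) => [?|hth].
    by exists B; [exact: leq_trans sB _ | left].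
  have [a ha] := @missed_step R A K I xi B I0 A0; exists (a :: B) => //; right.
  apply: le_trans ha _; rewrite -natr1 mulrDl mul1r opprD addrA lerB //.
  by rewrite lerXn2r ?nnegrE ?ltW // (lt_trans th0).
case=> B sB [hB | hB]; exists B => //; apply: le_trans hB _.
apply: le_trans (ltW th0); rewrite subr_le0 -ler_pdivrMr ?exprn_gt0 // div1r.
by apply: ltW; rewrite truncnS_gt.
Qed.

(** * Sampled forms control the bias of contractions *)

Section Fourier.
Context {R : rcfType} {F : finFieldType} {chi : F -> R[i]}.
Context (chiP : is_char chi).
Context {m : nat}.

Definition slice k (S : seq 'rV[F]_m -> F) (a : k.-tuple 'rV[F]_m) :
  {ffun 'rV[F]_m -> F} := [ffun y => S (y :: a)].

Lemma Re_avg (I : finType) (f : I -> R[i]) :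
  complex.Re (avg f) = avg (fun i => complex.Re (f i)).
Proof.
have ReM (c : R) z : complex.Re (c%:C * z) = c * complex.Re z.
  by case: z => a b /=; rewrite mul0r subr0.
rewrite /avg -(rmorph_nat (real_complex R)) -fmorphV ReM; congr (_ * _).
by apply: (big_morph (@complex.Re R)) => // [[a b] [c d]].
Qed.

Lemma zbias_zero_slice k (S : seq 'rV[F]_m -> F) :
  zbias k S = avg (fun a : k.-tuple 'rV[F]_m => (slice S a == 0)%:R) :> R.
Proof.
apply: eq_avg => a; congr (nat_of_bool _)%:R.
apply/forallP/eqP => [h | /ffunP h y]; last by have := h y; rewrite !ffunE => ->.
by apply/ffunP => y; rewrite !ffunE; exact/eqP.
Qed.

(** Let g z be the bias of S(z, .).  As S(y, .) is the difference of S(y + z, .)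
    and S(z, .), g y is at least the average over z of g (y + z) g z, which by
    orthogonality of characters is the average over a of chi (S(y, a)) times the
    collision probability of the linear form S(., a).  The samples B and all a
    with the same slice as a sample have S(y, a) = 0, hence contribute positively,
    and the others cost at most twice the missed mass. *)
Lemma zbias_fourier k (S : seq 'rV[F]_m -> F) y (B : seq (k.+1.-tuple 'rV[F]_m)) :
  symml k.+2 S -> (forall b : k.+1.-tuple 'rV[F]_m, b \in B -> S (y :: b) = 0) ->
  zbias k.+1 S ^+ 2 - 2 * missed (slice S) B <= zbias k (fun s => S (y :: s)) :> R.
Proof.
move=> hS SB; pose V := 'rV[F]_m; pose g z : R := zbias k (fun s => S (z :: s)).
have hSz z : symml k.+1 (fun s => S (z :: s)) by exact: symml_cons.
have submul : avg (fun z => g (y + z) * g z) <= g y.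
  rewrite -[X in _ <= X](@avg_const _ V) ?card_rV_gt0 //; apply: ler_avg => z.
  apply: le_trans (zbiasB chiP (hSz _) (hSz _)) _.
  rewrite le_eqVlt; apply/orP; left; apply/eqP; apply: eq_zbias => s sk.
  by rewrite (symmlD _ _ hS) ?sk // addrK.
have conv : (avg (fun z => g (y + z) * g z))%:C =
    avg (fun a : k.+1.-tuple V => chi (S (y :: a)) * (collision (slice S) a)%:C).
  rewrite avg_C (@eq_avg _ _ _ (fun z : V => avg (fun a : k.+1.-tuple V =>
    avg (fun b : k.+1.-tuple V => chi (S (y :: a)) *
      chi (S (z :: a) - S (z :: b)))))).
    rewrite avg_exchange; apply: eq_avg => a.
    rewrite avg_exchange avg_C -avgZ; apply: eq_avg => b.
    rewrite avgZ (avg_char_linear chiP); last first.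
      move=> c x x'; rewrite !(symmlP _ _ _ hS) ?size_tuple //; ring.
    rewrite rmorph_nat; congr (_ * (nat_of_bool _)%:R); apply/forallP/eqP.
      by move=> h; apply/ffunP => x; rewrite !ffunE; apply/eqP; rewrite eq_sym -subr_eq0.
    by move=> /ffunP h x; have := h x; rewrite !ffunE => ->; rewrite subrr.
  move=> z; rewrite rmorphM /= (zbias_char chiP) // /g -(zbiasN _ (fun s => S (z :: s))).
  rewrite (zbias_char chiP); last exact: symmlNf.
  rewrite avgM; apply: eq_avg => a; apply: eq_avg => b.
  by rewrite -!(charD chiP) (symmlD _ _ hS) ?size_tuple // addrA.
apply: le_trans submul.
have -> : avg (fun z => g (y + z) * g z) =
    avg (fun a : k.+1.-tuple V => complex.Re (chi (S (y :: a))) * collision (slice S) a).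
  rewrite -[LHS]/(complex.Re (_ %:C)) conv Re_avg; apply: eq_avg => a.
  by case: (chi _) => u v /=; rewrite mulr0 subr0.
apply: le_trans (_ : avg (fun a : k.+1.-tuple V => collision (slice S) a - 2 *
   (collision (slice S) a * (slice S a \notin [seq slice S b | b <- B])%:R)) <= _).
  rewrite avgB (avgZ 2); apply: lerB => //.
  rewrite zbias_zero_slice expr2 avgM; apply: ler_avg => a.
  apply: ler_avg => b; rewrite -natrM mulnb ler_nat.
  by case: eqP => // ->; case: eqP => // ->; rewrite eqxx.
apply: ler_avg => a; have c0 := @collision_ge0 R _ _ (slice S) a.
case: (boolP (_ \in _)) => [/mapP[b bB ab] | _] /=.
  have -> : S (y :: a) = 0 by move/ffunP/(_ y): ab; rewrite !ffunE (SB b bB).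
  by rewrite (char0 chiP) -[complex.Re 1]/(1 : R) mul1r !mulr0 subr0.
have : -1 <= complex.Re (chi (S (y :: a))).
  have := norm_char chiP (S (y :: a)); rewrite normc_def => /complexI h1.
  have : complex.Re (chi (S (y :: a))) ^+ 2 <= 1.
    have := sqr_sqrtr (addr_ge0 (sqr_ge0 (complex.Re (chi (S (y :: a)))))
                                (sqr_ge0 (complex.Im (chi (S (y :: a)))))).
    by rewrite h1 expr1n => {1}->; rewrite lerDl sqr_ge0.
  by move=> h2; nra.
by move=> h; rewrite mulr1; nra.
Qed.

End Fourier.

(** * Killing linear and bilinear forms *)

Section Linear.
Context {F : finFieldType}.

Lemma linear_form_col m (l : 'rV[F]_m -> F) :
  (forall a x y, l (a *: x + y) = a * l x + l y) ->
  exists L : 'cV[F]_m, forall x, l x = (x *m L) 0 0.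
Proof.
move=> lin; exists (\col_i l (delta_mx 0 i)) => x; rewrite mxE {1}[x]row_sum_delta.
have l0 : l 0 = 0 by have := lin (-1) 0 0; rewrite scaler0 addr0 mulN1r addNr.
transitivity (\sum_j x 0 j * l (delta_mx 0 j)); last by apply: eq_bigr => j _; rewrite mxE.
elim: (index_enum _) => [|j r IHr]; first by rewrite !big_nil.
by rewrite !big_cons lin IHr.
Qed.

Lemma ker_exists m c (N : 'M[F]_(m, c)) : (c < m)%N ->
  exists2 e : 'rV[F]_m, e != 0 & e *m N = 0.
Proof.
move=> cm; have /rowV0Pn[e /sub_kermxP eN e0] : kermx N != 0.
  by rewrite -mxrank_eq0 mxrank_ker subn_eq0 -ltnNge (leq_ltn_trans (rank_leq_col N)).
by exists e.
Qed.

(** Squaring is at most two-to-one, and one-to-one at 0. *)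
Lemma card_squares : (#|F| < 2 * #|[set a ^+ 2 | a : F]|)%N.
Proof.
set Q := [set _ | _ in _].
have Q0 : 0 \in Q by apply/imsetP; exists 0; rewrite ?inE // expr0n.
have -> : #|F| = (\sum_(y in Q) #|[pred a : F | a ^+ 2 == y]|)%N.
  rewrite -sum1_card (partition_big (fun a : F => a ^+ 2) (mem Q)) /=; last first.
    by move=> a _; apply/imsetP; exists a.
  by apply: eq_bigr => y _; rewrite sum1_card; apply: eq_card => a; rewrite !inE.
rewrite (bigD1 0) //= (cardD1 0 Q) Q0 mulnDr muln1.
have -> : #|[pred a : F | a ^+ 2 == 0]| = 1%N.
  by rewrite -(card1 (0 : F)); apply: eq_card => a; rewrite !inE expf_eq0.
rewrite add1n add2n !ltnS.
apply: (@leq_trans (\sum_(y in Q | y != 0%R) 2)%N).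
  apply: leq_sum => y /andP[/imsetP[b _ ->] _].
  apply: leq_trans (_ : #|[set b; - b]| <= 2)%N; last by rewrite cards2; case: eqP.
  by apply/subset_leq_card/fintype.subsetP => a; rewrite !inE eqf_sqr.
rewrite sum_nat_const mulnC leq_mul2l /=.
by apply/subset_leq_card/fintype.subsetP => y; rewrite !inE andbC.
Qed.

(** The values of a^2 q1 and of -(b^2 q2 + q3) both fill more than half of the
    field, so they meet. *)
Lemma diagonal_conic (q1 q2 q3 : F) : q1 != 0 -> q2 != 0 ->
  exists a b, a ^+ 2 * q1 + b ^+ 2 * q2 + q3 = 0.
Proof.
move=> q10 q20; pose Q := [set a ^+ 2 | a : F].
pose X := [set c * q1 | c in Q]; pose Y := [set - (c * q2 + q3) | c in Q].
have cX : #|X| = #|Q| by rewrite card_imset //; exact: mulIf.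
have cY : #|Y| = #|Q|.
  by rewrite card_imset // => c d /oppr_inj/addIr; exact: mulIf.
have /set0Pn[z] : X :&: Y != set0.
  rewrite -card_gt0 -subn_gt0 subn0 -(ltn_add2l #|X :|: Y|) addn0 cardsUI cX cY addnn.
  by rewrite -mul2n; apply: leq_ltn_trans card_squares; exact: max_card.
rewrite inE => /andP[/imsetP[_ /imsetP[a _ ->] ->]].
by case/imsetP=> _ /imsetP[b _ ->] e; exists a, b; rewrite -addrA e addNr.
Qed.

Section Isotropic.
Context {m : nat} {T : seq 'rV[F]_m -> F} (hT : symml 2 T).

Lemma form2C x y : T [:: x; y] = T [:: y; x].
Proof. by apply: (symml_perm hT) => //; rewrite -(cat1s x) -(cat1s y) perm_catC. Qed.

Lemma form2l z a x y : T [:: a *: x + y; z] = a * T [:: x; z] + T [:: y; z].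
Proof. by rewrite (symmlP _ _ _ hT). Qed.

Lemma form2r z a x y : T [:: z; a *: x + y] = a * T [:: z; x] + T [:: z; y].
Proof. by rewrite ![T [:: z; _]]form2C form2l. Qed.

(** Orthogonalise three vectors, the last two chosen in the kernel of the
    previous ones, and solve the resulting diagonal equation with coefficient 1
    at the third vector. *)
Lemma isotropic_vector : (2 < m)%N -> exists2 x, x != 0 & T [:: x; x] = 0.
Proof.
move=> m2; case: (boolP [exists x, (x != 0) && (T [:: x; x] == 0)]).
  by case/existsP => x /andP[x0 /eqP]; exists x.
move/existsPn => noiso; have iso x : x != 0 -> T [:: x; x] != 0.
  by move=> x0; have := noiso x; rewrite x0.
have [e1 e10 _] := @ker_exists m 0 0 (ltn_trans (isT : (0 < 2)%N) m2).
have [L1 hL1] := linear_form_col (form2l e1).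
have [e2 e20] := @ker_exists m 1 L1 (ltn_trans (isT : (1 < 2)%N) m2).
move/matrixP/(_ 0 0); rewrite -hL1 mxE => T21.
have [L2 hL2] := linear_form_col (form2l e2).
have [e3 e30] := @ker_exists m _ (row_mx L1 L2) m2.
rewrite mul_mx_row => e3L; have [T31 T32] : T [:: e3; e1] = 0 /\ T [:: e3; e2] = 0.
  move: e3L; rewrite -[0]row_mx0 => /eq_row_mx[].
  move=> /matrixP/(_ 0 0) + /matrixP/(_ 0 0).
  by rewrite -hL1 -hL2 !mxE.
have [a [b ab]] := diagonal_conic (T [:: e3; e3]) (iso _ e10) (iso _ e20).
exists (a *: e1 + (b *: e2 + e3)).
  apply: contraNneq (iso _ e30) => x0.
  have : T [:: a *: e1 + (b *: e2 + e3); e3] = 0.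
    rewrite x0; have := form2l e3 (-1) 0 0.
    by rewrite scaler0 addr0 mulN1r addNr.
  rewrite !form2l (form2C e1) (form2C e2) T31 T32 => e.
  by rewrite -e !mulr0 !add0r.
have [T12 T13 T23] : [/\ T [:: e1; e2] = 0, T [:: e1; e3] = 0 & T [:: e2; e3] = 0].
  by split; rewrite form2C.
by rewrite -[RHS]ab !(form2l, form2r) T12 T13 T21 T23 T31 T32; ring.
Qed.

End Isotropic.

(** Pass from m to a complement D of an isotropic vector x inside its orthogonal
    space: this costs two dimensions and gains one. *)
Lemma isotropic_space m (T : seq 'rV[F]_m -> F) : symml 2 T ->
  exists p (A : 'M[F]_(p, m)), [/\ row_free A, (m <= 2 * p.+1)%N &
    forall x y, T [:: x *m A; y *m A] = 0].
Proof.
elim/ltn_ind: m T => m IHm T hT; have [m2|m2] := leqP m 2.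
  exists 0%N, 0; split=> // [|x y]; first by rewrite /row_free mxrank0.
  by rewrite !mulmx0 (symml0 hT).
have [x x0 Txx] := isotropic_vector hT m2.
have [L hL] := linear_form_col (form2l hT x).
have rx : \rank x = 1%N by apply/eqP; rewrite rank_rV x0.
have xK : (x <= kermx L)%MS.
  by apply/sub_kermxP/matrixP => i j; rewrite !ord1 -hL Txx mxE.
pose D := (kermx L :\: x)%MS; pose B := row_base D.
have rD : (\rank D).+1 = \rank (kermx L).
  by rewrite -(mxrank_cap_compl (kermx L) x) (capmx_idPr xK) rx.
have rK : (m.-1 <= \rank (kermx L))%N.
  by rewrite mxrank_ker -subn1 leq_sub2l // rank_leq_col.
have Dm : (\rank D < m)%N by rewrite rD rank_leq_col.
have TB u : T [:: u *m B; x] = 0.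
  have /sub_kermxP uL : (u *m B <= kermx L)%MS.
    by apply: submx_trans (submxMl _ _) _; rewrite eq_row_base diffmxSl.
  by rewrite hL uL mxE.
have [p [A [fA pA TA]]] := IHm _ Dm _ (symml_pull B hT).
exists (1 + p)%N, (col_mx x (A *m B)); split.
- rewrite /row_free -addsmxE mxrank_disjoint_sum; last first.
    apply/eqP; rewrite -submx0 -(capmx_diff (kermx L) x) capmxC.
    by rewrite capmxS // (submx_trans (submxMl _ _)) ?eq_row_base.
  by rewrite rx mxrankMfree ?row_base_free // (eqP fA).
- by lia.
move=> u v; rewrite -[u]hsubmxK -[v]hsubmxK !mul_row_col !(mulmxA _ A B).
rewrite [lsubmx u]mx11_scalar [lsubmx v]mx11_scalar !mul_scalar_mx.
have := TA (rsubmx u) (rsubmx v); rewrite /pull /= => TAuv.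
by rewrite !(form2l hT, form2r hT) Txx TB (form2C hT x) TB TAuv; ring.
Qed.

End Linear.

(** Forms in one or two variables need no bias, whence the guard 2 < j.  The
    constant C precedes the field, so the loss of dimension is uniform in it; the
    successor absorbs the additive losses. *)
Definition zeroable (R : rcfType) (j : nat) (g : R) : Prop :=
  exists C : nat, forall (F : finFieldType) (chi : F -> R[i]), is_char chi ->
  forall m (T : seq 'rV[F]_m -> F), symml j T ->
    ((2 < j)%N -> g <= zbias j.-1 T) ->
    exists p (A : 'M[F]_(p, m)), [/\ row_free A, (m <= C * p.+1)%N &
      forall s, size s = j -> T (pull A s) = 0].


Section Zeroable.
Context {R : rcfType}.

Lemma zeroable1 (g : R) : zeroable 1 g.
Proof.
exists 1%N => F chi _ m T hT _.
have [|L hL] := @linear_form_col _ m (fun x => T [:: x]).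
  by move=> a x y; rewrite (symmlP _ _ _ hT).
exists (\rank (kermx L)), (row_base (kermx L)); split; first exact: row_base_free.
  have := rank_leq_col L; rewrite mxrank_ker; lia.
case=> [|u [|]] // _; rewrite /pull /= hL.
have /sub_kermxP -> : (u *m row_base (kermx L) <= kermx L)%MS.
  by apply: submx_trans (submxMl _ _) _; rewrite eq_row_base.
by rewrite mxE.
Qed.

Lemma zeroable2 (g : R) : zeroable 2 g.
Proof.
exists 2%N => F chi _ m T hT _; have [p [A [fA pA TA]]] := isotropic_space hT.
by exists p, A; split=> // -[|u [|v [|]]] // _; exact: TA.
Qed.

Lemma zeroable_family j (g : R) N : (0 < j)%N -> zeroable j g ->
  exists C : nat,
  forall (F : finFieldType) (chi : F -> R[i]), is_char chi ->
  forall m (T : nat -> seq 'rV[F]_m -> F),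
    (forall i, (i < N)%N -> symml j (T i) /\
      ((2 < j)%N -> g <= zbias j.-1 (T i))) ->
    exists p (A : 'M[F]_(p, m)), [/\ row_free A, (m <= C * p.+1)%N &
      forall i s, (i < N)%N -> size s = j -> T i (pull A s) = 0].
Proof.
move=> j0 [C0 zj]; elim: N => [|N [C IHN]].
  exists 1%N => F chi chiP m T _; exists m, 1%:M.
  by split; rewrite ?mul1n // row_free_unit unitmx1.
exists (C * C0.+1)%N => F chi chiP m T hT.
have [i iN|p [A [fA pA TA]]] := IHN F chi chiP m T; first exact/hT/ltnW.
have [hN bN] := hT N (ltnSn N).
have [|j2|q [B [fB qB TB]]] := zj F chi chiP p (fun s => T N (pull A s)).
- exact: symml_pull.
- apply: le_trans (bN j2) _; case: (j) j0 hN => // j' _ hN.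
  exact: (zbias_pull chiP).
exists q, (B *m A); split; first by rewrite /row_free mxrankMfree.
  by apply: leq_trans pA _; rewrite -mulnA leq_mul2l; lia.
move=> i s; rewrite ltnS leq_eqVlt pull_mul => /orP[/eqP-> | iN] sj.
  exact: TB.
by apply: TA; rewrite ?size_pull.
Qed.

End Zeroable.

(** * Cosets and cubes *)

Section Shift2.
Context {F : finFieldType}.

Lemma saddA m (s t u : seq 'rV[F]_m) : sadd (sadd s t) u = sadd s (sadd t u).
Proof.
elim: s t u => [|x s IHs] [|y t] [|z u] //; rewrite /sadd /= addrA.
by congr (_ :: _); exact: IHs.
Qed.

Lemma pull_sadd m p (A : 'M[F]_(p, m)) s t :
  pull A (sadd s t) = sadd (pull A s) (pull A t).
Proof.
elim: s t => [|x s IHs] [|y t] //; rewrite /sadd /pull /= mulmxDl.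
by congr (_ :: _); exact: IHs.
Qed.

Lemma nth_sadd m (s t : seq 'rV[F]_m) i : size s = size t -> (i < size s)%N ->
  nth 0 (sadd s t) i = (nth 0 s i : 'rV[F]_m) + (nth 0 t i : 'rV[F]_m).
Proof.
move=> st ls; rewrite (nth_map (0, 0)) ?size_zip -?st ?minnn //.
by rewrite nth_zip.
Qed.

Lemma coset_avg_le (R : realFieldType) m p n (A : 'M[F]_(p, m))
    (h : seq 'rV[F]_m -> R) :
  exists2 w, size w = n & avgs n (fun u => h (sadd w (pull A u))) <= avgs n h.
Proof.
have [|w hw] := @avg_le_ex R (n.-tuple 'rV[F]_m)
    (fun w => avgs n (fun u => h (sadd w (pull A u)))) (avgs n h) (card_tuple_rV_gt0 _ _ _).
  rewrite /avgs avg_exchange -[X in _ <= X](@avg_const _ (n.-tuple 'rV[F]_p)).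
    apply: ler_avg => u; rewrite le_eqVlt; apply/orP; left; apply/eqP.
    by apply: (avgs_sadd h); rewrite size_pull size_tuple.
  exact: card_tuple_rV_gt0.
by exists w; rewrite ?size_tuple.
Qed.

(** The sequences whose i-th entry is either x_i or x_i + u_i. *)
Fixpoint cube m (x u : seq 'rV[F]_m) : seq (seq 'rV[F]_m) :=
  if (x, u) is (x0 :: x', u0 :: u') then
    map (cons x0) (cube x' u') ++ map (cons (x0 + u0)) (cube x' u')
  else [:: [::]].

Lemma cube_sadd m p (A : 'M[F]_(p, m)) v w u :
  size v = size w -> size w = size u ->
  cube (sadd v (pull A w)) (pull A u) =
    [seq sadd v (pull A X) | X <- cube w u].
Proof.
elim: v w u => [|x v IHv] [|y w] [|z u] //= [vw] [wu].
have := IHv w u vw wu; rewrite /sadd /pull /= => IH.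
rewrite {}IH map_cat -!map_comp; congr (_ ++ _); apply: eq_map => X //=.
by rewrite mulmxDl addrA.
Qed.

Lemma size_cube m (x u X : seq 'rV[F]_m) :
  size x = size u -> X \in cube x u -> size X = size u.
Proof.
elim: x u X => [|x0 x IHx] [|u0 u] X //= => [_|[xu]]; first by rewrite inE => /eqP->.
by rewrite mem_cat => /orP[] /mapP[Y /IHx-/(_ xu) sY ->] /=; rewrite sY.
Qed.

(** For uniform x each of the 2 ^ n vertices of the cube is uniformly distributed. *)
Lemma avgs_cube (R : realFieldType) m n (h : seq 'rV[F]_m -> R) u : size u = n ->
  avgs n (fun x => \sum_(X <- cube x u) h X) = (2 ^ n)%:R * avgs n h.
Proof.
elim: n h u => [|n IHn] h [|u0 u] //= => [_|[su]].
  by rewrite !avgs0 big_seq1 mul1r.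
rewrite avgsS (@eq_avg _ _ _ (fun x =>
    (2 ^ n)%:R * avgs n (fun X => h (x :: X)) +
    (2 ^ n)%:R * avgs n (fun X => h (x + u0 :: X)))).
  rewrite avgD !(avgZ (2 ^ n)%:R) expnS mul2n -addnn natrD mulrDl avgsS.
  congr (_ + _); congr (_ * _); rewrite -[RHS](@avg_reindex _ _ _ (+%R^~ u0)).
    by apply: eq_avg.
  by exists (fun y => y - u0) => y; rewrite ?addrK ?subrK.
move=> x; rewrite -!(IHn _ u su) -avgD; apply: eq_avg => X /=.
by rewrite big_cat !big_map.
Qed.

End Shift2.

Section Cube.
Context {R : rcfType} {F : finFieldType} {chi : F -> R[i]}.
Context (chiP : is_char chi).

Lemma symml_mid m k (T : seq 'rV[F]_m -> F) a x c :
  symml k T -> (size a + size c).+1 = k -> T (a ++ x :: c) = T (x :: a ++ c).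
Proof.
move=> hT sk; apply: (symml_perm hT); first by rewrite size_cat /= addnS.
by rewrite -(cat1s x c) perm_catCA.
Qed.

(** u_i = (x_i + u_i) - x_i writes T(u, .) as an alternating sum of the forms at
    the vertices, so the biases get multiplied. *)
Lemma zbias_cube m n c (T : seq 'rV[F]_m -> F) x u (g : R) :
  symml (n + c.+1) T -> 0 <= g -> size x = n -> size u = n ->
  (forall X, X \in cube x u -> g <= zbias c (fun s => T (X ++ s))) ->
  g ^+ (2 ^ n) <= zbias c (fun s => T (u ++ s)).
Proof.
move=> + g0; elim: n T x u => [|n IHn] T [|x0 x] [|u0 u] // hT => [_ _|[sx] [su]] hX.
  by rewrite expr1; apply: hX; rewrite inE.
have hz z : symml (n + c.+1) (fun s => T (z :: s)) by exact: symml_cons.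
have h1 : g ^+ (2 ^ n) <= zbias c (fun s => T (x0 :: u ++ s)).
  apply: (IHn (fun s => T (x0 :: s)) x u) => // X XC; apply: (hX (x0 :: X)).
  by rewrite /= mem_cat map_f.
have h2 : g ^+ (2 ^ n) <= zbias c (fun s => T (x0 + u0 :: u ++ s)).
  apply: (IHn (fun s => T (x0 + u0 :: s)) x u) => // X XC; apply: (hX (x0 + u0 :: X)).
  by rewrite /= mem_cat map_f ?orbT.
have hc z : symml c.+1 (fun s => T (z :: u ++ s)).
  by apply: (symml_cat (w := z :: u) hT); rewrite /= su.
rewrite expnS mul2n -addnn exprD.
apply: le_trans (ler_pM _ _ h2 h1) _; rewrite ?exprn_ge0 //.
apply: le_trans (zbiasB chiP (hc _) (hc _)) _.
rewrite le_eqVlt; apply/orP; left; apply/eqP; apply: eq_zbias => s sc.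
by rewrite -(symmlB _ _ hT) ?size_cat ?su ?sc // addrAC subrr add0r.
Qed.

Lemma zbias_prefix m (T : seq 'rV[F]_m -> F) (g : R) c e w :
  symml (size w + e + c.+1) T ->
  (forall X, size X = (size w + e)%N -> g <= zbias c (fun s => T (X ++ s))) ->
  g <= zbias (e + c) (fun s => T (w ++ s)).
Proof.
elim: e w => [|e IHe] w hT hX; first by apply: hX; rewrite addn0.
rewrite addSn zbiasS; last by apply: (symml_cat hT); lia.
rewrite -[X in X <= _](@avg_const _ 'rV[F]_m) ?card_rV_gt0 //; apply: ler_avg => x.
rewrite (@eq_zbias _ _ _ _ _ (fun s => T (rcons w x ++ s))); last first.
  by move=> s _; rewrite cat_rcons.
by apply: IHe; rewrite size_rcons addSnnS.
Qed.

End Cube.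

Section CosetKill.
Context {F : finFieldType}.

(** Multilinear expansion of entries v_i + w_i A.  In each resulting term some
    of the v_i have become w_i A and thus joined the subspace: a term other than
    the one with no w_i has fewer than r entries v_i left and vanishes.  The
    condition Q restricts the arguments us in that one term. *)
Lemma expand_coset m p n k l r (T : seq 'rV[F]_m -> F) (A : 'M[F]_(p, m))
    (v : seq 'rV[F]_m) (w : seq 'rV[F]_p) b (Q : seq 'rV[F]_p -> Prop) :
  symml (k + l) T -> size v = n -> size w = n -> size b = l ->
  let admissible a us := ((a < r)%N \/ a = r /\ Q us) /\ (a + size us)%N = k in
  (forall J us, all (ltn^~ n) J -> admissible (size J) us ->
    T (map (nth 0 v) J ++ pull A us ++ b) = 0) ->
  forall pre J us, all (ltn^~ n) pre -> all (ltn^~ n) J ->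
    admissible (size pre + size J)%N us ->
    T (map (nth 0 v) pre ++ map (nth 0 (sadd v (pull A w))) J ++
       pull A us ++ b) = 0.
Proof.
move=> hT sv sw sb adm vanish pre J; elim: J pre => [|i J IHJ] pre us hpre.
  by rewrite addn0 => _; exact: vanish.
case/andP=> iN hJ [ha hsz]; rewrite /= nth_sadd ?size_pull ?sv ?sw //.
have hk : (size (map (nth 0 v) pre) + size (map (nth 0 (sadd v (pull A w))) J ++ pull A us ++ b)).+1
    = (k + l)%N.
  by move: hsz => /=; rewrite !size_cat size_pull !size_map sb; lia.
rewrite (symml_mid _ hT) // (symmlD _ _ hT); last by rewrite size_cat.
have -> : T (nth 0 v i :: map (nth 0 v) pre ++ map (nth 0 (sadd v (pull A w))) J ++
    pull A us ++ b) = 0.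
  apply: (IHJ (i :: pre)) => //; first by rewrite /= hpre andbT.
  by rewrite /= addSnnS.
have -> : nth 0 (pull A w) i = nth 0 w i *m A by rewrite (nth_map 0) ?sw.
rewrite add0r catA -(symml_mid _ hT) -?catA; last first.
  by move: hk; rewrite !size_cat size_pull !size_map; lia.
apply: (IHJ pre (nth 0 w i :: us)) => //; split; last by move: hsz => /=; lia.
by left; case: ha => [|[]] /=; lia.
Qed.

End CosetKill.

Lemma tuple_of_bounded n r J : all (ltn^~ n) J -> size J = r ->
  exists t : r.-tuple 'I_n, map val t = J.
Proof.
move=> hJ sJ; have vJ : map val (pmap (insub : nat -> option 'I_n) J) = J.
  rewrite (pmap_filter (@insubK _ _ _)); apply/all_filterP.
  by apply: sub_all hJ => x xn /=; rewrite insubT.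
have st : size (pmap (insub : nat -> option 'I_n) J) == r.
  by rewrite -(size_map val) vJ sJ.
by exists (Tuple st).
Qed.

(** * Increasing the number of freely chosen vectors *)

Section Kill.
Context {R : rcfType}.

(** The forms T(., b_i) must vanish at (v + u, y) for u and y in the subspace, so
    each mixed term with some v_j and otherwise vectors of the subspace has to be
    killed.  But the translate v must be chosen after the subspace, to keep the
    average of h on the coset small.  Both are met by induction on the number r of
    entries v_j allowed: shrinking the subspace kills the terms with r such entries,
    and moving v inside the previous subspace preserves what was gained, by
    [expand_coset]. *)
Lemma coset_kill n k (g : R) N r : (n.+1 + k.+1 <= 5)%N -> (r <= n.+1)%N ->
  (forall j, (0 < j <= n.+1)%N -> zeroable j g) ->
  exists C : nat, forall (F : finFieldType) (chi : F -> R[i]), is_char chi ->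
  forall m (T : seq 'rV[F]_m -> F), symml (n.+1 + k.+1) T ->
    (forall X, size X = n -> g <= zbias k.+1 (fun s => T (X ++ s))) ->
  forall b : nat -> seq 'rV[F]_m, (forall i, size (b i) = k.+1) ->
  forall h : seq 'rV[F]_m -> R,
  exists p (A : 'M[F]_(p, m)) v, [/\ row_free A, (m <= C * p.+1)%N, size v = n,
    avgs n (fun u => h (sadd v (pull A u))) <= avgs n h &
    forall i J us, (i < N)%N -> all (ltn^~ n) J -> (size J < r)%N ->
      (size J + size us = n.+1)%N ->
      T (map (nth 0 v) J ++ pull A us ++ b i) = 0].
Proof.
move=> nk5 + zj; elim: r => [_|r IHr rn].
  exists 1%N => F chi chiP m T hT hX b sb h.
  exists m, 1%:M, (nseq n 0); split=> //; rewrite ?size_nseq ?mul1n //.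
    by rewrite row_free_unit unitmx1.
  rewrite le_eqVlt; apply/orP; left; apply/eqP; apply: eq_avgs => s <-.
  congr h; elim: s => // x s IHs.
  by rewrite /= /sadd /= mulmx1 add0r; congr (_ :: _).
have [C IH] := IHr (ltnW rn).
(* The forms to kill at this level: r entries of v and one sample fixed. *)
pose fam : finType := (r.-tuple 'I_n * 'I_N)%type.
have j0 : (0 < n.+1 - r)%N by lia.
have jn : (0 < n.+1 - r <= n.+1)%N by lia.
have [C1 zfam] := zeroable_family #|fam| j0 (zj _ jn).
exists (C * C1.+1)%N => F chi chiP m T hT hX b sb h.
have [p [A [v [fA pA sv hv vanish]]]] := IH F chi chiP m T hT hX b sb h.
pose w0 (e : fam) := map (nth 0 v) (map val e.1) ++ b e.2.
pose S e us := if insub e is Some o then T (w0 (enum_val (o : 'I_#|fam|)) ++ pull A us)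
               else 0.
have sw0 e : size (w0 e) = (r + k.+1)%N by rewrite size_cat !size_map size_tuple sb.
have [e eN|q [B [fB qB SB]]] := zfam F chi chiP p S.
  rewrite /S insubT; set w := w0 _.
  have hTw : symml (n.+1 - r) (fun us => T (w ++ us)).
    by apply: (symml_cat hT); rewrite sw0; lia.
  split; first exact: (symml_pull A hTw).
  (* Three or more free slots out of at most five leave at most two occupied
     ones, while every contraction with n >= 2 vectors is biased. *)
  move=> j2; have -> : (n.+1 - r).-1 = (n - (r + k.+1) + k.+1)%N by lia.
  have bw : g <= zbias (n - (r + k.+1) + k.+1) (fun us => T (w ++ us)).
    apply: zbias_prefix => [|X sX]; last by apply: hX; rewrite sX sw0; lia.
    by have -> : (size w + (n - (r + k.+1)) + k.+2)%N = (n.+1 + k.+1)%N by rewrite sw0; lia.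
  apply: le_trans bw (zbias_pull chiP A _).
  by have -> : (n - (r + k.+1) + k.+1).+1 = (n.+1 - r)%N by lia.
have [w sw hw] := coset_avg_le n B (fun u => h (sadd v (pull A u))).
exists q, (B *m A), (sadd v (pull A w)); split.
- by rewrite /row_free mxrankMfree.
- by apply: leq_trans pA _; rewrite -mulnA leq_mul2l; lia.
- by rewrite size_sadd ?size_pull ?sv.
- apply: le_trans hv; apply: le_trans hw.
  rewrite le_eqVlt; apply/orP; left; apply/eqP; apply: eq_avgs => u _.
  by rewrite pull_mul saddA pull_sadd.
move=> i J us iN hJ sJ sJu; rewrite pull_mul.
apply: (expand_coset (n := n) (k := n.+1) (l := k.+1) (r := r)
  (Q := fun us => exists us', us = pull B us') hT sv sw (sb i) _ (pre := [::])) => //.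
  move=> J' us' hJ' [[sJ'|[sJ' [u ->]]] su]; first exact: vanish.
  have [t tJ] := tuple_of_bounded hJ' sJ'.
  have := SB (enum_rank ((t, Ordinal iN) : fam)) u (ltn_ord _).
  rewrite /S valK enum_rankK /w0 /= tJ => Su; rewrite size_pull sJ' in su; rewrite -[RHS]Su; last by lia.
  apply: (symml_perm hT); first by rewrite !size_cat size_map !size_pull sb sJ'; lia.
  by rewrite -catA perm_cat2l perm_catC.
split; last by rewrite size_pull.
by move: sJ; rewrite ltnS leq_eqVlt => /orP[/eqP|]; [right; split; [|exists us]|left].
Qed.
End Kill.

Section Step.
Context {R : realType}.

(** Here n vectors X and one vector y are fixed, and k + 1 slots remain beside X
    and y.  The function h X is the mass missed by the samples for the form T(X, .);
    theta is chosen so that h is at most g^2 / 4 at all vertices of some cube, and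
    [zbias_fourier] then leaves bias g^2 - 2 g^2 / 4 there. *)
Lemma bias_step n k (g : R) : (n.+1 + k.+1 <= 5)%N -> 0 < g ->
  (forall j, (0 < j <= n.+1)%N -> zeroable j g) ->
  exists2 g' : R, 0 < g' & exists C : nat,
  forall (F : finFieldType) (chi : F -> R[i]), is_char chi ->
  forall m (T : seq 'rV[F]_m -> F), symml (n.+1 + k.+1) T ->
    (forall X, size X = n -> g <= zbias k.+1 (fun s => T (X ++ s))) ->
  exists p (A : 'M[F]_(p, m)), [/\ row_free A, (m <= C * p.+1)%N &
    forall Y, size Y = n.+1 -> g' <= zbias k (fun s => T (pull A (Y ++ s)))].
Proof.
move=> nk5 g0 zj; pose theta := g ^+ 2 / 4 / (2 ^ n)%:R.
have pow0 : 0 < (2 ^ n)%:R :> R by rewrite ltr0n expn_gt0.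
have g20 : 0 < g ^+ 2 by rewrite exprn_gt0.
have [|M hit] := @hitting_set R theta; first by rewrite !divr_gt0.
have [C kill] := coset_kill M nk5 (leqnn _) zj.
exists ((g ^+ 2 / 2) ^+ (2 ^ n)); first by rewrite exprn_gt0 // divr_gt0.
exists C => F chi chiP m T hT hX; pose V := 'rV[F]_m.
have [B sB hB] := hit (n.-tuple V) (k.+1.-tuple V) {ffun V -> F}
  (fun X a => slice (fun s => T (X ++ s)) a)
  (card_tuple_rV_gt0 _ _ _) (card_tuple_rV_gt0 _ _ _).
pose b i : seq V := nth [tuple 0 | _ < k.+1] B i.
have sb i : size (b i) = k.+1 by rewrite size_tuple.
pose h (X : seq V) : R :=
  missed (fun a : k.+1.-tuple V => slice (fun s => T (X ++ s)) a) B.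
have [p [A [v [fA pA sv hv van]]]] := kill F chi chiP m T hT hX b sb h.
exists p, A; split=> // -[//|y u] [su].
pose H (X : seq 'rV[F]_p) := h (sadd v (pull A X)).
(* A cube with directions u all of whose vertices are good. *)
have [w] : exists w : n.-tuple 'rV[F]_p, \sum_(X <- cube w u) H X <= g ^+ 2 / 4.
  apply: avg_le_ex (card_tuple_rV_gt0 _ _ _) _.
  rewrite -[avg _]/(avgs n (fun w => \sum_(X <- cube w u) H X)) avgs_cube //.
  by rewrite mulrC -ler_pdivlMr //; apply: le_trans hv hB.
move=> hw.
have Hw X : X \in cube w u -> H X <= g ^+ 2 / 4.
  move=> XC; apply: le_trans hw; rewrite (big_rem X) //= lerDl.
  by rewrite sumr_ge0 // => Z _; exact: missed_ge0.
have hTy : symml (n + k.+1) (fun s => T (y *m A :: s)) by exact: symml_cons.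
apply: le_trans (_ : zbias k (fun s => T (y *m A :: pull A u ++ s)) <= _); last first.
  have hTu : symml k.+1 (fun s => T (y *m A :: pull A u ++ s)).
    by apply: (symml_cat (w := y *m A :: pull A u) hT); rewrite /= size_pull su.
  apply: le_trans (zbias_pull chiP A hTu) _; rewrite le_eqVlt; apply/orP; left.
  by apply/eqP/eq_zbias => s _; rewrite /pull /= map_cat.
apply: (zbias_cube chiP (x := sadd v (pull A w)) hTy).
- by rewrite ltW // divr_gt0.
- by rewrite size_sadd ?size_pull ?size_tuple.
- by rewrite size_pull.
rewrite cube_sadd ?sv ?size_tuple // => _ /mapP[X XC ->].
have sX : size X = n by rewrite (size_cube _ XC) ?size_tuple.
have ssX : size (sadd v (pull A X)) = n by rewrite size_sadd ?size_pull ?sX.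
have := @zbias_fourier R F chi chiP m k (fun s => T (sadd v (pull A X) ++ s)) (y *m A) B.
rewrite -/(h _) -/(H _) => four.
rewrite (@eq_zbias _ _ _ _ _ (fun s => T (sadd v (pull A X) ++ y *m A :: s))); last first.
  by move=> s sk; rewrite (symml_mid _ hT) // ssX sk addSn.
apply: le_trans (four _ _).
- have := hX _ ssX; have := Hw X XC; set z := zbias _ _ => h1 h2.
  have : g ^+ 2 <= z ^+ 2 by rewrite lerXn2r ?nnegrE ?(le_trans (ltW g0) h2) // ltW.
  lra.
- by apply: (symml_cat hT); rewrite ssX; lia.
move=> c cB; have cM : (index c B < M)%N by rewrite (leq_trans _ sB) // index_mem.
have -> : tval c = b (index c B) by rewrite /b nth_index.
have -> : sadd v (pull A X) = map (nth 0 (sadd v (pull A X))) (iota 0 n).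
  by rewrite -[X in iota 0 X]ssX -/(mkseq _ _) mkseq_nth.
apply: (expand_coset (n := n) (k := n.+1) (l := k.+1) (r := n.+1)
  (Q := fun=> False) hT sv sX (sb _) _ (pre := [::]) (us := [:: y])) => //.
- by move=> J us hJ [[lt|[_ []]] sz]; exact: van.
- by apply/allP => i; rewrite mem_iota.
by split; rewrite size_iota; [left | rewrite addn1].
Qed.

End Step.

(** The stages i = 0, ..., d - 1 produce subspaces on which any i vectors may be
    fixed.  At stage d - 1 the remaining bias is that of a linear form, which is 0 or 1. *)
Lemma zeroable_le5 (R : realType) d (g : R) : (0 < d <= 5)%N -> 0 < g ->
  zeroable d g.
Proof.
elim/ltn_ind: d g => d IHd g /andP[d0 d5] g0.
have [d2|d2] := leqP d 2.
  have [->|->] : d = 1%N \/ d = 2%N by lia.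
    exact: zeroable1.
  exact: zeroable2.
have stage i : (i < d)%N -> exists2 g' : R, 0 < g' & exists C : nat,
    forall (F : finFieldType) (chi : F -> R[i]), is_char chi ->
    forall m (T : seq 'rV[F]_m -> F), symml d T -> g <= zbias d.-1 T ->
    exists p (A : 'M[F]_(p, m)), [/\ row_free A, (m <= C * p.+1)%N &
      forall Y, size Y = i ->
        g' <= zbias (d.-1 - i) (fun s => T (pull A (Y ++ s)))].
  elim: i => [_|i IHi id].
    exists g => //; exists 1%N => F chi chiP m T hT gT; exists m, 1%:M.
    split; rewrite ?mul1n ?row_free_unit ?unitmx1 // => Y /size0nil ->.
    apply: le_trans gT _; rewrite subn0; apply: (zbias_pull chiP).
    by rewrite prednK.
  have [g1 g10 [C1 st1]] := IHi (ltnW id).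
  have [k dk] : exists k, d = (i.+1 + k.+1)%N by exists (d - i.+2)%N; lia.
  have [|j ji|g2 g20 [C2 st2]] := @bias_step R i k g1 _ g10; first by rewrite -dk.
    by apply: IHd => //; lia.
  exists g2 => //; exists (C1 * C2.+1)%N => F chi chiP m T hT gT.
  have [p [A [fA pA hA]]] := st1 F chi chiP m T hT gT.
  have [||q [B [fB qB hB]]] := st2 F chi chiP p (fun s => T (pull A s)).
  - by rewrite -dk; exact: symml_pull.
  - by move=> X sX; have := hA X sX; have -> : (d.-1 - i = k.+1)%N by lia.
  exists q, (B *m A); split; first by rewrite /row_free mxrankMfree.
    by apply: leq_trans pA _; rewrite -mulnA leq_mul2l; lia.
  move=> Y sY; have := hB Y sY; have -> : (d.-1 - i.+1 = k)%N by lia.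
  move=> h; apply: le_trans h _; rewrite le_eqVlt; apply/orP; left.
  by apply/eqP/eq_zbias => s _; rewrite pull_mul.
have [|g' g'0 [C st]] := stage d.-1; first by rewrite prednK.
exists C => F chi chiP m T hT gT.
have [p [A [fA pA hA]]] := st F chi chiP m T hT (gT d2).
exists p, A; split=> // s; case/lastP: s => [|s y]; first by move=> /= d1; lia.
rewrite size_rcons => sd; have := hA s; rewrite -sd => /(_ erefl).
rewrite subnn /zbias avgs0 => /(lt_le_trans g'0).
case: (boolP [forall _, _]) => [/forallP h _ | _]; last by rewrite ltxx.
by have /eqP := h y; rewrite cats1.
Qed.

(** * Degree and differences *)

Section Derivatives.
Context {F : finFieldType} {m : nat}.
Implicit Types (f : 'rV[F]_m -> F) (s t : seq 'rV[F]_m).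

Definition deriv1 (h : 'rV[F]_m) f : 'rV[F]_m -> F := fun x => f (x + h) - f x.

Fixpoint derivs f s : 'rV[F]_m -> F :=
  if s is h :: s' then derivs (deriv1 h f) s' else f.

(** Degree defined through differences: unlike a bound on the degree of some
    representing polynomial it passes to subspaces and is read off the top
    differences by [deg_le_derivs]. *)
Fixpoint deg_le d f : Prop :=
  if d is d'.+1 then forall h, deg_le d' (deriv1 h f) else forall x y, f x = f y.

Lemma deriv1C h k f : deriv1 h (deriv1 k f) = deriv1 k (deriv1 h f).
Proof.
by apply: boolp.funext => x; rewrite /deriv1 (addrAC x h k); ring.
Qed.

Lemma derivsD f g s x :
  derivs (fun y => f y + g y) s x = derivs f s x + derivs g s x.
Proof.
elim: s f g => //= h s IHs f g; rewrite -IHs; congr (derivs _ s x).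
by apply: boolp.funext => y; rewrite /deriv1; ring.
Qed.

Lemma derivs_mid f s h t : derivs f (s ++ h :: t) = derivs f (h :: s ++ t).
Proof. by elim: s f => //= k s IHs f; rewrite IHs /= deriv1C. Qed.

Lemma derivs_perm f s t : perm_eq s t -> derivs f s = derivs f t.
Proof.
elim: s t f => [|h s IHs] t f; first by rewrite perm_sym => /perm_nilP ->.
move=> st; have ht : h \in t by rewrite -(perm_mem st) mem_head.
case/splitPr: ht st => t1 t2; rewrite perm_sym -(cat1s h t2) perm_catCA cat1s perm_cons perm_sym => st.
by rewrite derivs_mid /=; exact: IHs.
Qed.

Lemma derivs_deg_le d f s : deg_le d f -> size s = d.+1 -> derivs f s = (fun=> 0).
Proof.
elim: d f s => [|d IHd] f [|h s] //= hf [sd]; last exact: IHd.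
by case: s sd => // _; apply: boolp.funext => x /=; rewrite /deriv1 (hf _ x) subrr.
Qed.

Lemma derivs_const d f s x y : deg_le d f -> size s = d ->
  derivs f s x = derivs f s y.
Proof.
by elim: d f s => [|d IHd] f [|h s] //= hf [sd]; exact: IHd.
Qed.

Lemma deg_le_derivs d f : (forall s x, size s = d.+1 -> derivs f s x = 0) -> deg_le d f.
Proof.
elim: d f => [|d IHd] f hf /=.
  move=> x y; have := hf [:: x - y] y erefl; rewrite /= /deriv1 (addrC y) subrK.
  by move/eqP; rewrite subr_eq0 => /eqP.
by move=> h; apply: IHd => s x sd; apply: (hf (h :: s)); rewrite /= sd.
Qed.

Lemma deg_leS d f : deg_le d f -> deg_le d.+1 f.
Proof.
move=> hf; apply: deg_le_derivs => -[|h s] x //= [sd].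
have := derivs_deg_le hf (s := belast h s); rewrite size_belast => /(_ sd) D0.
have -> : derivs (deriv1 h f) s = derivs f (h :: s) by [].
rewrite lastI (@derivs_perm _ _ (last h s :: belast h s)) ?perm_rcons //=.
have D c : derivs (deriv1 (last h s) f) c = deriv1 (last h s) (derivs f c).
  elim: c (f) => //= k c IHc f'; by rewrite -IHc deriv1C.
by rewrite D D0 /deriv1 subrr.
Qed.

Lemma deg_leW d e f : (d <= e)%N -> deg_le d f -> deg_le e f.
Proof.
by move=> /subnKC <-; elim: (e - d)%N => [|j IHj]; rewrite ?addn0 // addnS => /IHj/deg_leS.
Qed.

Lemma deg_leD d f g : deg_le d f -> deg_le d g -> deg_le d (fun x => f x + g x).
Proof.
move=> hf hg; apply: deg_le_derivs => s x sd.
by rewrite derivsD (derivs_deg_le hf sd) (derivs_deg_le hg sd) addr0.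
Qed.

Lemma deg_leZ d c f : deg_le d f -> deg_le d (fun x => c * f x).
Proof.
elim: d f => [|d IHd] f hf /=; first by move=> x y; rewrite (hf x y).
move=> h; have -> : deriv1 h (fun x => c * f x) = (fun x => c * deriv1 h f x).
  by apply: boolp.funext => x; rewrite /deriv1 mulrBr.
exact: IHd.
Qed.

Lemma deg_le_shift d f h : deg_le d f -> deg_le d (fun x => f (x + h)).
Proof.
elim: d f => [|d IHd] f hf /= => [x y|k]; first exact: hf.
have -> : deriv1 k (fun x => f (x + h)) = (fun x => deriv1 k f (x + h)).
  by apply: boolp.funext => x; rewrite /deriv1 addrAC.
exact: IHd.
Qed.

Lemma deg_le_coord d f (i : 'I_m) : deg_le d f -> deg_le d.+1 (fun x => x 0 i * f x).
Proof.
elim: d f => [|d IHd] f hf h.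
  have -> : deriv1 h (fun x => x 0 i * f x) = (fun x => h 0 i * f x).
    by apply: boolp.funext => x; rewrite /deriv1 (hf _ x) mxE; ring.
  exact: (@deg_leZ 0).
have -> : deriv1 h (fun x => x 0 i * f x) =
    (fun x => x 0 i * deriv1 h f x + h 0 i * f (x + h)).
  by apply: boolp.funext => x; rewrite /deriv1 mxE; ring.
by apply: (@deg_leD d.+1); [exact: IHd | exact/(@deg_leZ d.+1)/(@deg_le_shift d.+1)].
Qed.

(** Additivity holds up to a difference of order d + 1, which is zero; over a
    prime field additive maps are linear. *)
Lemma symml_derivs d f : (forall a : F, exists n : nat, a = n%:R) ->
  deg_le d f -> symml d (fun s => derivs f s 0).
Proof.
move=> prime_field hf; split=> [s t _ st | a x y s sd].
  by rewrite (derivs_perm _ st).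
have add (x' y' : 'rV[F]_m) : derivs f (x' + y' :: s) 0 =
    derivs f (x' :: s) 0 + derivs f (y' :: s) 0.
  have h0 : derivs f [:: y', x' & s] 0 = 0 by rewrite (derivs_deg_le hf) //= sd.
  rewrite -[RHS]addr0 -h0 /= -!derivsD; congr (derivs _ s 0).
  by apply: boolp.funext => z; rewrite /deriv1 (addrAC z) -addrA (addrC y'); ring.
have [n ->] := prime_field a; rewrite add; congr (_ + _).
elim: n => [|n IHn].
  rewrite scale0r mul0r; have := add 0 0; rewrite addr0.
  by move/eqP; rewrite -subr_eq0 opprD addrA subrr add0r oppr_eq0 => /eqP.
by rewrite -natr1 scalerDl scale1r add IHn mulrDl mul1r.
Qed.

End Derivatives.

Lemma derivs_affine (F : finFieldType) m p (f : 'rV[F]_m -> F) (A : 'M[F]_(p, m)) v s u :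
  derivs (fun u => f (v + u *m A)) s u = derivs f (pull A s) (v + u *m A).
Proof.
elim: s f => //= h s IHs f; rewrite -IHs; congr (derivs _ s u).
by apply: boolp.funext => x; rewrite /deriv1 mulmxDl addrA.
Qed.

Lemma deg_le_affine (F : finFieldType) m p d (f : 'rV[F]_m -> F) (A : 'M[F]_(p, m)) v :
  deg_le d f -> deg_le d (fun u => f (v + u *m A)).
Proof.
move=> hf; apply: deg_le_derivs => s u sd.
by rewrite derivs_affine (derivs_deg_le hf) // size_pull.
Qed.

(** * From a biased function to a biased form *)

Section Weyl.
Context {R : rcfType} {F : finFieldType} {chi : F -> R[i]}.
Context (chiP : is_char chi).
Context (prime_field : forall a : F, exists n : nat, a = n%:R).
Lemma normc_avg (I : finType) (z : I -> R[i]) :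
  normc (avg z) <= avg (fun i => normc (z i)).
Proof. by rewrite -lecR avg_C; exact: norm_avg. Qed.

Lemma charN a : chi (- a) = conjc (chi a).
Proof.
have ca0 : chi a != 0 by rewrite -normr_eq0 (norm_char chiP) oner_eq0.
apply: (mulfI ca0); rewrite -(charD chiP) subrr (char0 chiP).
have := norm_char chiP a; move/(congr1 (fun z => z ^+ 2)).
rewrite -add_Re2_Im2 expr1n; case: (chi a) => x y /= [e].
by apply/eqP; rewrite eq_complex /=; apply/andP; split; apply/eqP; lra.
Qed.

(** Expanding the square and substituting y = x + h. *)
Lemma normc_avg_sqr m (f : 'rV[F]_m -> F) :
  (normc (avg (fun x => chi (f x))) ^+ 2)%:C =
  avg (fun h => avg (fun x => chi (deriv1 h f x))).
Proof.
set z := avg _; have zz : (normc z ^+ 2)%:C = z * conjc z.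
  rewrite rmorphXn /= -[(normc z)%:C]/`|z| -add_Re2_Im2.
  by case: z => a b /=; apply/eqP; rewrite eq_complex /=; apply/andP; split; apply/eqP; ring.
have zc : conjc z = avg (fun x => chi (- f x)).
  rewrite /z /avg rmorphM fmorphV rmorph_nat rmorph_sum; congr (_ * _).
  by apply: eq_bigr => x _; rewrite charN.
rewrite zz zc mulrC avgM [RHS]avg_exchange; apply: eq_avg => x.
rewrite -[LHS](@avg_reindex _ _ _ (+%R x)); last first.
  by exists (fun y => - x + y) => y; rewrite ?addKr ?addNKr.
by apply: eq_avg => h /=; rewrite /deriv1 (charD chiP) mulrC.
Qed.

Lemma avg_pow2 (I : finType) (y : I -> R) d : (0 < #|I|)%N ->
  (forall i, 0 <= y i) -> avg y ^+ (2 ^ d) <= avg (fun i => y i ^+ (2 ^ d)).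
Proof.
move=> I0 y0; elim: d => [|d IHd] //.
rewrite expnSr exprM; under [X in _ <= X]eq_avg => i do rewrite exprM.
apply: le_trans (avg_sqr _ I0); rewrite lerXn2r // nnegrE.
  by rewrite exprn_ge0 // avg_ge0.
by apply: avg_ge0 => i; rewrite exprn_ge0.
Qed.

Lemma normc_ge0 (z : R[i]) : 0 <= normc z.
Proof. by rewrite -ler0c -[(normc z)%:C]/`|z| normr_ge0. Qed.

(** Weyl differencing: square, apply the induction hypothesis to each difference
    of f, and use convexity to bring the power inside the average. *)
Lemma bias_le_zbias d m (f : 'rV[F]_m -> F) : deg_le d.+1 f ->
  normc (avg (fun x => chi (f x))) ^+ (2 ^ d.+1) <= zbias d (fun s => derivs f s 0).
Proof.
elim: d f => [|d IHd] f hf.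
  rewrite -lecR normc_avg_sqr (zbias_char chiP (symml_derivs prime_field hf)).
  rewrite avgsS le_eqVlt; apply/orP; left; apply/eqP; apply: eq_avg => h.
  rewrite avgs0 -[RHS](@avg_const _ 'rV[F]_m) ?card_rV_gt0 //.
  by apply: eq_avg => x /=; rewrite (hf h _ 0).
have sq : normc (avg (fun x => chi (f x))) ^+ 2 <=
    avg (fun h => normc (avg (fun x => chi (deriv1 h f x)))).
  rewrite -[X in X <= _]ger0_norm ?sqr_ge0 //.
  have -> : `|normc (avg (fun x => chi (f x))) ^+ 2| =
     normc (normc (avg (fun x => chi (f x))) ^+ 2)%:C.
    apply: complexI; rewrite -[RHS]/`|_%:C| normc_def /= expr0n addr0 sqrtr_sqr //.
  by rewrite normc_avg_sqr; exact: normc_avg.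
rewrite expnS exprM; apply: le_trans (_ : avg (fun h =>
    normc (avg (fun x => chi (deriv1 h f x)))) ^+ (2 ^ d.+1) <= _).
  by rewrite lerXn2r ?nnegrE ?sqr_ge0 // avg_ge0 // => h; exact: normc_ge0.
apply: le_trans (avg_pow2 _ _ _) _; first exact: card_rV_gt0.
  by move=> h; exact: normc_ge0.
rewrite (zbiasS (symml_derivs prime_field hf)); apply: ler_avg => h.
exact: IHd.
Qed.

End Weyl.


(** The form killed at each stage is the top difference of f, so that f loses a
    degree on all cosets of the subspace; by the triangle inequality one of these
    cosets carries at least the bias of the whole space. *)
Lemma biased_const (R : realType) d (delta : R) : (d <= 5)%N -> 0 < delta ->
  exists C : nat, forall (F : finFieldType) (chi : F -> R[i]), is_char chi ->
  (forall a : F, exists n : nat, a = n%:R) ->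
  forall m (f : 'rV[F]_m -> F), deg_le d f ->
    delta <= normc (avg (fun x => chi (f x))) ->
  exists p (A : 'M[F]_(p, m)) v, [/\ row_free A, (m <= C * p.+1)%N &
    forall u, f (v + u *m A) = f v].
Proof.
elim: d => [_ _|d IHd d5 delta0].
  exists 1%N => F chi chiP pF m f hf _; exists m, 1%:M, 0.
  by split; rewrite ?mul1n ?row_free_unit ?unitmx1 // => u; exact: hf.
have [C1 z] := @zeroable_le5 R d.+1 (delta ^+ (2 ^ d.+1)) d5 (exprn_gt0 _ delta0).
have [C2 IH] := IHd (ltnW d5) delta0.
exists (C1 * C2.+1)%N => F chi chiP pF m f hf hb.
have [|p [A [fA pA TA]]] := z F chi chiP m _ (symml_derivs pF hf).
  move=> _; apply: le_trans (bias_le_zbias chiP pF hf).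
  by rewrite lerXn2r ?nnegrE ?(ltW delta0) // (le_trans (ltW delta0)).
have [v hv] : exists v, delta <= normc (avg (fun u => chi (f (v + u *m A)))).
  apply: avg_ge_ex; first exact: card_rV_gt0.
  apply: le_trans (normc_avg _); apply: le_trans hb _.
  rewrite le_eqVlt; apply/orP; left; apply/eqP; congr normc.
  rewrite avg_exchange -[LHS](@avg_const _ 'rV[F]_p) ?card_rV_gt0 //.
  apply: eq_avg => u; rewrite -[LHS](@avg_reindex _ _ _ (+%R^~ (u *m A))) //.
  by exists (fun y => y - u *m A) => y; rewrite ?addrK ?subrK.
have [|q [B [w [fB qB cB]]]] := IH F chi chiP pF p (fun u => f (v + u *m A)) _ hv.
  apply: deg_le_derivs => s u sd; rewrite derivs_affine.
  by rewrite (derivs_const _ 0 hf) ?size_pull // TA.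
exists q, (B *m A), (v + w *m A); split; first by rewrite /row_free mxrankMfree.
  by apply: leq_trans pA _; rewrite -mulnA leq_mul2l; lia.
by move=> u; have := cB u; rewrite mulmxDl addrA mulmxA.
Qed.

(** * Polynomials, roots of unity and affine subspaces *)

Section Poly.
Import mpoly.
Context {q : nat}.

(** A monomial is a product of coordinates, and multiplying by a coordinate
    raises the difference degree by at most one. *)
Lemma has_degree_deg_le n d (f : 'rV['F_q]_n -> 'F_q) :
  has_degree f d -> deg_le d f.
Proof.
case=> p [_ fp sp].
have -> : f = fun x => \sum_(m <- msupp p)
    p@_m * \prod_i x 0 i ^+ (m i).
  by apply: boolp.funext => x; rewrite fp mevalE.
have mono (r : seq 'I_n) (e : 'I_n -> nat) :
    deg_le (\sum_(i <- r) e i)%N (fun x : 'rV['F_q]_n => \prod_(i <- r) x 0 i ^+ e i).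
  elim: r => [|i r IHr].
    by rewrite big_nil => x y; rewrite !big_nil.
  rewrite big_cons; have -> : (fun x : 'rV['F_q]_n => \prod_(j <- i :: r) x 0 j ^+ e j) =
      (fun x => x 0 i ^+ e i * \prod_(j <- r) x 0 j ^+ e j).
    by apply: boolp.funext => x; rewrite big_cons.
  elim: (e i) => [|k IHk].
    have -> : (fun x : 'rV['F_q]_n => x 0 i ^+ 0 * \prod_(j <- r) x 0 j ^+ e j) =
       (fun x => \prod_(j <- r) x 0 j ^+ e j) by apply: boolp.funext => x; rewrite mul1r.
    exact: IHr.
  have -> : (fun x : 'rV['F_q]_n => x 0 i ^+ k.+1 * \prod_(j <- r) x 0 j ^+ e j) =
       (fun x => x 0 i * (x 0 i ^+ k * \prod_(j <- r) x 0 j ^+ e j)).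
    by apply: boolp.funext => x; rewrite exprS mulrA.
  exact: deg_le_coord.
have : {subset msupp p <= msupp p} by [].
elim: {1 3}(msupp p) => [|m s IHs] sub.
  apply: (@deg_leW _ _ 0) => // x y; by rewrite !big_nil.
have -> : (fun x : 'rV['F_q]_n => \sum_(m0 <- m :: s)
    p@_m0 * \prod_i x 0 i ^+ (m0 i)) =
  (fun x => p@_m * \prod_i x 0 i ^+ (m i) +
    \sum_(m0 <- s) p@_m0 * \prod_i x 0 i ^+ (m0 i)).
  by apply: boolp.funext => x; rewrite big_cons.
apply: deg_leD; last by apply: IHs => m' m's; apply: sub; rewrite inE m's orbT.
apply: deg_leZ; apply: deg_leW (mono _ _).
have := msize_mdeg_lt (sub m (mem_head _ _)); rewrite sp ltnS.
by rewrite mdegE.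
Qed.

End Poly.

Local Close Scope complex_scope.
From mathcomp Require Import all_classical all_reals all_analysis.

Section Omega.
Context {R : realType} {q : nat}.
Context (pq : prime q).

Lemma omegaX k : omega R q ^+ k =
  Complex (cos (k%:R * (2 * pi / q%:R))) (sin (k%:R * (2 * pi / q%:R))).
Proof.
elim: k => [|k IHk]; first by rewrite expr0 !mul0r cos0 sin0.
rewrite exprS IHk /omega; set t := 2 * pi / q%:R.
have -> : k.+1%:R * t = t + k%:R * t by rewrite -natr1; ring.
rewrite cosD sinD.
by apply/eqP; rewrite eq_complex /=; apply/andP; split; apply/eqP; ring.
Qed.

Lemma omega_char : is_char (fun a : 'F_q => omega R q ^+ (a : nat)).
Proof.
have q0 : q%:R != 0 :> R by rewrite pnatr_eq0 -lt0n prime_gt0.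
have wq : omega R q ^+ q = 1.
  by rewrite omegaX mulrC divfK // mulr_natl cos2pi sin2pi.
split.
- move=> a b; rewrite -exprD -[in RHS](expr_mod _ wq); congr (_ ^+ _).
  by congr (_ %% _)%N; exact: (Fp_cast pq).
- move=> a; rewrite omegaX normc_def /= cos2Dsin2 sqrtr1 //.
exists 1; have -> : nat_of_ord (1 : 'F_q) = 1%N.
  by have := val_Fp_nat pq 1; rewrite modn_small ?prime_gt1.
rewrite expr1 /omega eq_complex /= negb_and.
have pi0 := pi_gt0 R.
(* The angle 2 pi / q is pi if q = 2, and lies strictly below pi otherwise. *)
have [q3|q2] := leqP 3 q; last first.
  have -> : q = 2%N by have := prime_gt1 pq; lia.
  have -> : 2 * pi / 2 = pi :> R by field.
  by rewrite cospi; apply/orP; left; apply/eqP; lra.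
apply/orP; right; rewrite gt_eqF // sin_gt0_pi //.
have q3R : 3 <= q%:R :> R by rewrite ler_nat.
have qR : 0 < q%:R :> R by lra.
by rewrite divr_gt0 ?ltr_pdivrMr //=; nra.
Qed.

End Omega.

Section Parametrization.
Context {F : finFieldType} {n : nat}.

Lemma vspace_mx (U : {vspace 'rV[F]_n}) :
  exists2 A : 'M[F]_(\dim U, n), row_free A &
    forall x, x \in U <-> exists u, x = u *m A.
Proof.
pose b := vbasis U; pose A := \matrix_(i < \dim U) tnth b i.
have AE (c : 'rV[F]_(\dim U)) : c *m A = \sum_i c 0 i *: b`_i.
  by rewrite mulmx_sum_row; apply: eq_bigr => i _; rewrite rowK (tnth_nth 0).
exists A.
  apply: inj_row_free => c; rewrite AE => c0; apply/rowP => i; rewrite mxE.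
  by move/freeP: (basis_free (vbasisP U)); apply.
move=> x; split=> [xU|[u ->]].
  exists (\row_i coord b i x); rewrite AE {1}(coord_vbasis xU).
  by apply: eq_bigr => i _; rewrite mxE.
rewrite AE; apply: memv_suml => i _; apply: memvZ.
by rewrite vbasis_mem // mem_nth // size_tuple.
Qed.

Lemma mx_vspace p (A : 'M[F]_(p, n)) : row_free A ->
  exists2 U : {vspace 'rV[F]_n}, \dim U = p &
    forall x, (x \in U) -> exists u, x = u *m A.
Proof.
move=> fA; pose l := linfun (mulmxr A : 'rV[F]_p -> 'rV[F]_n).
have kl : lker l == 0%VS.
  by apply/lker0P => u v; rewrite !lfunE /=; exact: row_free_inj.
exists (limg l).
  by rewrite limg_dim_eq ?(eqP kl) ?capv0 // dimvf /dim /= mul1n.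
by move=> x /memv_imgP[u _ ->]; exists u; rewrite lfunE.
Qed.

End Parametrization.

Lemma bias_affine_subspace (R : realType) q n (f : 'rV['F_q]_n -> 'F_q) v U
    (A : 'M['F_q]_(\dim U, n)) :
  row_free A -> (forall x, x \in U <-> exists u, x = u *m A) ->
  bias R f (affine_subspace v U) =
    normc (avg (fun u => omega R q ^+ (f (v + u *m A) : nat))).
Proof.
move=> fA UA; have -> : affine_subspace v U = [set v + u *m A | u : 'rV_(\dim U)]%SET.
  apply/setP => x; apply/imsetP/imsetP => [[y /UA[u ->] ->]|[u _ ->]].
    by exists u.
  by exists (u *m A) => //; apply/UA; exists u.
have inj : injective (fun u : 'rV_(\dim U) => v + u *m A).
  by move=> u u' /addrI; exact: row_free_inj.
rewrite /bias /avg card_imset // big_imset /=; last by move=> ? ? _ _; exact: inj.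
by congr (normc (_ * _)).
Qed.

Theorem corollary1p6 (R : realType) (delta : R) (hdelta : 0 < delta) :
  exists2 C : R, 0 < C &
    forall (q n k : nat), prime q -> (1 <= n)%N -> (1 <= k)%N ->
    forall f : 'rV['F_q]_n -> 'F_q,
      has_degree f 5 ->
      affine_disperser f k ->
      affine_extractor f (C * k%:R) delta.
Proof.
have [C hC] := @biased_const R 5 delta (leqnn _) hdelta.
(* From (C + 1) k <= m <= C (p + 1) and 0 < k it follows that k <= p. *)
exists C.+1%:R; first by rewrite ltr0n.
move=> q n k pq _ k1 f degf disp v U; rewrite -natrM ler_nat => kU.
rewrite leNgt; apply/negP => biasf.
have [A fA UA] := vspace_mx U.
rewrite (bias_affine_subspace R f v fA UA) in biasf.
have pF (a : 'F_q) : exists j : nat, a = j%:R by exists a; rewrite natr_Zp.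
have [p [B [w [fB pB cB]]]] := hC _ _ (omega_char pq) pF _ _
  (deg_le_affine A v (has_degree_deg_le degf)) (ltW biasf).
have [W dW WB] : exists2 W : {vspace 'rV['F_q]_n}, \dim W = p &
    forall x, x \in W -> exists u, x = u *m (B *m A).
  by apply: mx_vspace; rewrite /row_free mxrankMfree.
apply: (disp (v + w *m A) W); last first.
  exists (f (v + w *m A)) => x /imsetP[y /WB[u ->] ->].
  by have := cB u; rewrite mulmxDl addrA mulmxA.
rewrite dW leqNgt; apply/negP => pk.
have := leq_trans kU pB; rewrite mulSn leqNgt => /negP[].
apply: leq_ltn_trans (_ : C * k < k + C * k)%N; first by rewrite leq_mul2l pk orbT.
by rewrite -{1}[(C * k)%N]add0n ltn_add2r.
Qed.
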